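(* Let $n\ge 2$, let $\tau\in\mathcal M(\mathbb I^n)$, and let $x\in\mathbb I^n$ be a point minimizing the function $p\mapsto\mu_{\mathrm{dS}^n}(\tau\triangle\sigma_p)$ over $p\in\mathbb I^n$. Let $b=b_{\tau,x}:S^{n-1}\to\mathbb R$ be the border function of $\tau$ with base point $x$, and suppose $b\neq0$ almost everywhere on $S^{n-1}$. Then $$\int_{S^{n-1}}\operatorname{sgn}(b(\omega))\,\omega\,d\omega=0 .$$
   Context: On $\mathbb R^{n+1}$ put $\langle x,y\rangle=-x_0y_0+x_1y_1+\cdots+x_ny_n$. Let $\mathbb I^n=\{x:\langle x,x\rangle=-1,\ x_0>0\}$ (hyperboloid model of hyperbolic space), $o=(1,0,\dots,0)$, and $\mathrm{dS}^n=\{u:\langle u,u\rangle=1\}$. Write $u(r,\omega)=(\sinh r,\cosh r\,\omega)$, $r\in\mathbb R$, $\omega\in S^{n-1}$; this parametrizes $\mathrm{dS}^n\cong\mathbb R\times S^{n-1}$, and $d\mu_{\mathrm{dS}^n}=\cosh^{n-1}r\,dr\,d\omega$ with $d\omega$ the standard measure on $S^{n-1}$ (this measure is invariant under the isometry group $SO^+(n,1)$ of $\mathbb I^n$). For $u\in\mathrm{dS}^n$ let $H_u=\{x\in\mathbb I^n:\langle x,u\rangle>0\}$ (open half-space) and $H_u^c=\mathbb I^n\setminus H_u$ (closed half-space). Sections. A wall is a pair $\{H_u,H_u^c\}$. A section chooses one half-space of each wall; it is identified with the set of $u\in\mathrm{dS}^n$ such that $H_u$ is chosen. It is admissible if, whenever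 a chosen half-space (open or closed) is contained in a half-space $k$, then $k$ is chosen. The point section of $x\in\mathbb I^n$ is $\sigma_x=\{u\in\mathrm{dS}^n:\langle x,u\rangle>0\}$. $\mathcal M(\mathbb I^n)$ is the set of measurable admissible sections $\tau\subset\mathrm{dS}^n$ with $\mu_{\mathrm{dS}^n}(\tau\triangle\sigma_o)<\infty$; distances in $\mathcal M(\mathbb I^n)$ are a positive constant multiple of $\mu_{\mathrm{dS}^n}(\tau\triangle\tau')$. Border function. Fix $\tau\in\mathcal M(\mathbb I^n)$ and $x\in\mathbb I^n$, and choose $g\in SO^+(n,1)$ with $g(o)=x$ ($g$ the identity if $x=o$). For each $\omega\in S^{n-1}$ there is a unique $b_{\tau,x}(\omega)\in\mathbb R$ such that $g\,u(r,\omega)\in\tau$ for $r<b_{\tau,x}(\omega)$ and $g\,u(r,\omega)\notin\tau$ for $r>b_{\tau,x}(\omega)$. The function $b_{\tau,x}$ is the border function of $\tau$ with base point $x$ (depending on $g$ only through a rotation of $S^{n-1}$). *)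

(* Defs.v *)
From HB Require Import structures.
From mathcomp Require Import all_boot all_order all_algebra.
From mathcomp Require Import all_classical all_reals all_analysis.
From mathcomp Require Import measurable_realfun.

Set Implicit Arguments.
Unset Strict Implicit.
Unset Printing Implicit Defensive.

Import Order.TTheory GRing.Theory Num.Theory.
Import numFieldNormedType.Exports.

Local Open Scope classical_set_scope.
Local Open Scope ring_scope.

Definition cons_cV (R : realType) (n : nat) (t : R) (y : 'cV[R]_n) :
  'cV[R]_n.+1 := col_mx t%:M y.

Definition cV_display : measure_display -> measure_display.
Proof. exact. Qed.

(* Product sigma-algebra on R^n, generated by the coordinates; it is the Borel
   sigma-algebra. *)
Section measurable_cV.
Variables (R : realType) (n : nat).

Let coord (i : 'I_n) (x : 'cV[R]_n) : measurableTypeR R := x i 0.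

Let cV_set0 : g_sigma_preimage coord set0.
Proof. exact: sigma_algebra0. Qed.

Let cV_setC A : g_sigma_preimage coord A -> g_sigma_preimage coord (~` A).
Proof. exact: sigma_algebraC. Qed.

Let cV_bigcup (F : _^nat) : (forall i, g_sigma_preimage coord (F i)) ->
  g_sigma_preimage coord (\bigcup_i (F i)).
Proof. exact: sigma_algebra_bigcup. Qed.

HB.instance Definition _ := @isMeasurable.Build (cV_display default_measure_display)
  'cV[R]_n (g_sigma_preimage coord) cV_set0 cV_setC cV_bigcup.

End measurable_cV.

Section measurable_cV_theory.
Variable R : realType.
Local Notation RM := (measurableTypeR R).

Lemma measurable_coord n (i : 'I_n) :
  measurable_fun [set: 'cV[R]_n] (fun x => x i 0 : RM).
Proof.
move=> _ Y mY; rewrite setTI; apply: sub_sigma_algebra => /=.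
rewrite -bigcup_seq/=; exists i => /=; first by rewrite mem_index_enum.
by exists Y => //; rewrite setTI.
Qed.

Lemma measurable_fun_cVP d (T : measurableType d) n (f : T -> 'cV[R]_n) :
  (forall i, measurable_fun [set: T] (fun x => f x i 0 : RM)) ->
  measurable_fun [set: T] f.
Proof.
move=> mf _ Y mY; rewrite setTI.
pose coord (i : 'I_n) (x : 'cV[R]_n) : RM := x i 0.
suff: image_set_system setT f (measurable : set (set T)) Y.
  by rewrite /image_set_system /= setTI.
move: Y mY; apply: smallest_sub.
  exact/sigma_algebra_image/sigma_algebra_measurable.
case: n => [|n] in f mf coord *; first by rewrite big_ord0.
rewrite -bigcup_mkord_ord; apply: bigcup_sub => i _ A [B mB <-].
rewrite /image_set_system /= setTI setTI.
by have := mf (inord i) measurableT B mB; rewrite setTI.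
Qed.

Lemma cons_cV0 n (t : R) (y : 'cV[R]_n) : cons_cV t y 0 0 = t.
Proof.
have -> : 0 = lshift n (0 : 'I_1) :> 'I_n.+1 by apply/val_inj.
by rewrite (@col_mxEu _ 1 n 1 t%:M y) mxE eqxx mulr1n.
Qed.

Lemma cons_cVS n (t : R) (y : 'cV[R]_n) i : cons_cV t y (lift 0 i) 0 = y i 0.
Proof.
have -> : lift 0 i = rshift 1 i :> 'I_n.+1 by apply/val_inj.
by rewrite (@col_mxEd _ 1 n 1 t%:M y).
Qed.

Lemma measurable_cons_cV n :
  measurable_fun [set: RM * 'cV[R]_n] (fun p => cons_cV p.1 p.2).
Proof.
apply: measurable_fun_cVP => i; have [j ->|->] := unliftP 0 i.
  rewrite (_ : (fun _ => _) = (fun x : 'cV[R]_n => x j 0 : RM) \o snd).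
    exact: (measurableT_comp (measurable_coord j)).
  by apply/funext => p /=; rewrite cons_cVS.
by rewrite (_ : (fun _ => _) = fst)//; apply/funext => p; rewrite cons_cV0.
Qed.

Lemma measurable_uncons_cV n :
  measurable_fun [set: 'cV[R]_n.+1]
    (fun x => (x 0 0 : RM, dsubmx (x : 'cV[R]_(1 + n)))).
Proof.
apply/measurable_fun_pairP; split; first exact: (measurable_coord 0).
apply: measurable_fun_cVP => i /=.
rewrite (_ : (fun _ => _) =
    (fun x : 'cV[R]_n.+1 => x (rshift 1 i : 'I_n.+1) 0 : RM)).
  exact: measurable_coord.
by apply/funext => x; rewrite mxE.
Qed.

End measurable_cV_theory.

(* Lebesgue measure on R^n: the n-fold product of the one on R. *)
Fixpoint lebesgue_cV (R : realType) (n : nat) : set 'cV[R]_n -> \bar R :=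
  match n with
  | 0 => \d_(0 : 'cV[R]_0)
  | m.+1 => fun A => (@lebesgue_measure R \x @lebesgue_cV R m)%E
      [set p | A (cons_cV p.1 p.2)]
  end.


Section lebesgue_cV_measure.
Variable R : realType.
Local Notation RM := (measurableTypeR R).

Section step.
Variables (n : nat) (m : {sigma_finite_measure set 'cV[R]_n -> \bar R}).

Let l : {sigma_finite_measure set RM -> \bar R} := @lebesgue_measure R.
Let f (p : RM * 'cV[R]_n) : 'cV[R]_n.+1 := cons_cV p.1 p.2.
Let mf : measurable_fun setT f. Proof. exact: measurable_cons_cV. Qed.
Let g (x : 'cV[R]_n.+1) : RM * 'cV[R]_n :=
  (x 0 0, dsubmx (x : 'cV[R]_(1 + n))).

Let gf : g \o f = id.
Proof. by apply/funext => -[a b]; rewrite /= /g cons_cV0 /f /cons_cV col_mxKd. Qed.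

Definition lebesgue_step : set 'cV[R]_n.+1 -> \bar R :=
  pushforward (l \x m)%E f.

Let step0 : lebesgue_step set0 = 0%E. Proof. exact: measure0. Qed.

Let step_ge0 A : (0 <= lebesgue_step A)%E. Proof. exact: measure_ge0. Qed.

Let step_sigma_additive : semi_sigma_additive lebesgue_step.
Proof. exact: measure_semi_sigma_additive. Qed.

HB.instance Definition _ := isMeasure.Build _ _ _ lebesgue_step
  step0 step_ge0 step_sigma_additive.

Let step_sigma_finite : sigma_finite setT lebesgue_step.
Proof.
have /sigma_finiteP[F [FT ndF Foo]] := sigma_finiteT l.
have /sigma_finiteP[G [GT ndG Goo]] := sigma_finiteT m.
have mFG k : measurable (F k `*` G k).
  by apply: measurableX; [case: (Foo k)|case: (Goo k)].
exists (fun k => g @^-1` (F k `*` G k)).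
  apply/esym; rewrite -preimage_bigcup -[RHS](preimage_setT g); congr preimage.
  apply/seteqP; split => // -[a b] _.
  have [i _ Fa] : (\bigcup_k F k) a by rewrite -FT.
  have [j _ Gb] : (\bigcup_k G k) b by rewrite -GT.
  exists (maxn i j) => //; split => /=.
    by move: a Fa; exact/subsetPset/ndF/leq_maxl.
  by move: b Gb; exact/subsetPset/ndG/leq_maxr.
move=> k; split.
  by rewrite -[X in measurable X]setTI; exact: (@measurable_uncons_cV R n).
rewrite /lebesgue_step /pushforward -comp_preimage gf.
have [? ?] := Foo k; have [? ?] := Goo k.
by rewrite [ltLHS]product_measure1E// lte_mul_pinfty// ge0_fin_numE.
Qed.

HB.instance Definition _ := Measure_isSigmaFinite.Build _ _ _ lebesgue_step
  step_sigma_finite.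

End step.

Lemma lebesgue_cV_is_measure n :
  exists m : {sigma_finite_measure set 'cV[R]_n -> \bar R},
    @lebesgue_cV R n = m.
Proof.
elim: n => [|n [m mE]]; first by exists \d_(0 : 'cV[R]_0).
exists (lebesgue_step m) => /=; rewrite mE; exact/funext.
Qed.

Let lebesgue_cV0 n : @lebesgue_cV R n set0 = 0%E.
Proof. by have [m ->] := lebesgue_cV_is_measure n; rewrite measure0. Qed.

Let lebesgue_cV_ge0 n A : (0 <= @lebesgue_cV R n A)%E.
Proof. by have [m ->] := lebesgue_cV_is_measure n. Qed.

Let lebesgue_cV_sigma_additive n : semi_sigma_additive (@lebesgue_cV R n).
Proof.
have [m ->] := lebesgue_cV_is_measure n.
exact: measure_semi_sigma_additive.
Qed.

HB.instance Definition _ n := isMeasure.Build _ _ _ (@lebesgue_cV R n)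
  (lebesgue_cV0 n) (@lebesgue_cV_ge0 n) (@lebesgue_cV_sigma_additive n).

Let lebesgue_cV_sigma_finite n : sigma_finite setT (@lebesgue_cV R n).
Proof.
by have [m ->] := lebesgue_cV_is_measure n; exact: sigma_finiteT.
Qed.

HB.instance Definition _ n := Measure_isSigmaFinite.Build _ _ _
  (@lebesgue_cV R n) (@lebesgue_cV_sigma_finite n).

Lemma measurable_cube n :
  measurable [set x : 'cV[R]_n | forall i, `|x i 0| <= 1].
Proof.
rewrite (_ : [set _ | _] =
    \bigcap_(i in [set: 'I_n]) ((fun x : 'cV[R]_n => x i 0 : RM) @^-1`
      `[(- 1)%R, 1%R]%classic)); last first.
  apply/seteqP; split => x /=.
    by move=> h i _ /=; rewrite in_itv/= -ler_norml.
  by move=> h i; have := h i I; rewrite /= in_itv/= -ler_norml.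
apply: fin_bigcap_measurable => // i _.
by rewrite -[X in measurable X]setTI; exact: measurable_coord.
Qed.

Lemma lebesgue_cV_cube n :
  lebesgue_cV [set x : 'cV[R]_n | forall i, `|x i 0| <= 1] = (2 ^+ n)%:E.
Proof.
elim: n => [|n IH]; first by rewrite /= diracE mem_set//= => -[].
rewrite [LHS]/= (_ : [set _ | _] = `[(- 1)%R, 1%R]%classic `*`
    [set x : 'cV[R]_n | forall i, `|x i 0| <= 1]).
  rewrite (@product_measure1E _ _ _ _ _ (@lebesgue_measure R) (@lebesgue_cV R n))//.
    rewrite exprS EFinM; congr (_ * _)%E; last exact: IH.
    by rewrite [LHS](lebesgue_measure_itv `[(- 1)%R, 1%R]) /= lte_fin gtrN// -EFinB opprK.
  exact: measurable_cube.
apply/seteqP; split => -[a b] /=.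
  move=> h; split; first by have := h 0; rewrite cons_cV0 in_itv/= ler_norml.
  by move=> i; have := h (lift 0 i); rewrite cons_cVS.
rewrite in_itv/= -ler_norml => -[h0 h] i.
by have [j ->|->] := unliftP 0 i; rewrite ?cons_cV0 ?cons_cVS.
Qed.

End lebesgue_cV_measure.

Definition enorm (R : realType) (n : nat) (x : 'cV[R]_n) : R :=
  Num.sqrt (\sum_(i < n) x i 0 ^+ 2).

Definition sphere (R : realType) (n : nat) : set 'cV[R]_n :=
  [set w | enorm w = 1].

(* Surface measure on the unit sphere of R^n, as a measure on R^n that is
   concentrated on the sphere: n times the Lebesgue measure of the cone
   { t w : 0 < t <= 1, w in A and |w| = 1 }. *)
Definition sphere_measure (R : realType) (n : nat) (A : set 'cV[R]_n) :
    \bar R :=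
  (n%:R%:E * lebesgue_cV
    [set x : 'cV[R]_n | A ((enorm x)^-1 *: x) /\ (0 < enorm x <= 1)%R])%E.

Section sphere_measure.
Variables (R : realType) (n : nat).
Local Notation RM := (measurableTypeR R).

Lemma measurable_enorm :
  measurable_fun [set: 'cV[R]_n] (@enorm R n : _ -> RM).
Proof.
apply: (@measurableT_comp _ _ _ _ _ _ (@Num.sqrt R : RM -> RM)).
  apply: continuous_measurable_fun; exact: sqrt_continuous.
apply: measurable_sum => i.
by apply: measurable_funX; exact: measurable_coord.
Qed.

Let nrm (x : 'cV[R]_n) := (enorm x)^-1 *: x.

Let mnrm : measurable_fun setT nrm.
Proof.
apply: measurable_fun_cVP => i.
rewrite (_ : (fun _ => _) = (fun x => (enorm x) `^ (-1) * x i 0)).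
  apply: measurable_funM; last exact: measurable_coord.
  apply: (@measurableT_comp _ _ _ _ _ _ (@powR R ^~ (-1) : RM -> RM)).
    exact: measurable_powR.
  exact: measurable_enorm.
by apply/funext => x; rewrite mxE powR_inv1// sqrtr_ge0.
Qed.

Let ball := [set x : 'cV[R]_n | 0 < enorm x <= 1].

Let mball : measurable ball.
Proof.
rewrite (_ : ball = (@enorm R n : _ -> RM) @^-1` `]0%R, 1%R]%classic).
  by rewrite -[X in measurable X]setTI; exact: measurable_enorm.
by apply/seteqP; split => x /=; rewrite in_itv.
Qed.

Let sm : set 'cV[R]_n -> \bar R :=
  pushforward (mrestr (@lebesgue_cV R n) mball) nrm.

Let sm0 : sm set0 = 0%E. Proof. exact: measure0. Qed.

Let sm_ge0 A : (0 <= sm A)%E. Proof. exact: measure_ge0. Qed.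

Let sm_sigma_additive : semi_sigma_additive sm.
Proof. exact: measure_semi_sigma_additive. Qed.

HB.instance Definition _ := isMeasure.Build _ _ _ sm
  sm0 sm_ge0 sm_sigma_additive.

Let sphere_measureE : @sphere_measure R n = mscale (n%:R)%:nng sm.
Proof. by []. Qed.

Let sphere_measure0 : @sphere_measure R n set0 = 0%E.
Proof. by rewrite sphere_measureE measure0. Qed.

Let sphere_measure_ge0 A : (0 <= @sphere_measure R n A)%E.
Proof. by rewrite sphere_measureE measure_ge0. Qed.

Let sphere_measure_sigma_additive : semi_sigma_additive (@sphere_measure R n).
Proof. rewrite sphere_measureE; exact: measure_semi_sigma_additive. Qed.

HB.instance Definition _ := isMeasure.Build _ _ _ (@sphere_measure R n)
  sphere_measure0 sphere_measure_ge0 sphere_measure_sigma_additive.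

Let sphere_measure_fin : fin_num_fun (@sphere_measure R n).
Proof.
move=> A mA; rewrite ge0_fin_numE//.
apply: (@le_lt_trans _ _ (n%:R%:E * (2 ^+ n)%:E)%E); last by rewrite -EFinM ltry.
apply: lee_wpmul2l => //; rewrite -lebesgue_cV_cube.
apply: le_measure; rewrite ?inE.
- apply: measurableI; last exact: mball.
  by rewrite -[X in measurable X]setTI; exact: mnrm.
- exact: measurable_cube.
- move=> x /= [_ /andP[_ x1]] i; apply: le_trans x1.
  rewrite -sqrtr_sqr ler_sqrt ?sumr_ge0// => [|j _]; last exact: sqr_ge0.
  by rewrite (bigD1 i)//= lerDl sumr_ge0// => j _; exact: sqr_ge0.
Qed.

HB.instance Definition _ := Measure_isFinite.Build _ _ _
  (@sphere_measure R n) sphere_measure_fin.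

End sphere_measure.

Definition sinh (R : realType) (r : R) : R := (expR r - expR (- r)) / 2.

Definition cosh (R : realType) (r : R) : R := (expR r + expR (- r)) / 2.

(* Lorentzian form on R^(n+1); the coordinate of index 0 is the time. *)
Definition minkowski (R : realType) (n : nat) (x y : 'cV[R]_n.+1) : R :=
  - (x 0 0 * y 0 0) + \sum_(i < n) x (lift 0 i) 0 * y (lift 0 i) 0.

Definition hyperboloid (R : realType) (n : nat) : set 'cV[R]_n.+1 :=
  [set x | minkowski x x = -1 /\ 0 < x 0 0].

Definition origin (R : realType) (n : nat) : 'cV[R]_n.+1 := cons_cV 1 0.

Definition deSitter (R : realType) (n : nat) : set 'cV[R]_n.+1 :=
  [set u | minkowski u u = 1].

Definition polar_dS (R : realType) (n : nat) (r : R) (w : 'cV[R]_n) :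
  'cV[R]_n.+1 := cons_cV (sinh r) (cosh r *: w).

(* The measure cosh^(n-1) r dr dw on R x S^(n-1), transported to R^(n+1) by
   polar_dS; it is concentrated on de Sitter space. *)
Definition mu_dS (R : realType) (n : nat) (A : set 'cV[R]_n.+1) : \bar R :=
  (\int[@lebesgue_measure R \x @sphere_measure R n]_(p in
      [set p | A (polar_dS p.1 p.2)]) (cosh p.1 ^+ n.-1)%:E)%E.

Section mu_dS_measure.
Variables (R : realType) (n : nat).
Local Notation RM := (measurableTypeR R).

Lemma measurable_cosh : measurable_fun [set: RM] (@cosh R : _ -> RM).
Proof.
apply: measurable_funM => //; apply: measurable_funD => //.
exact: (measurableT_comp (@measurable_expR R)).
Qed.

Lemma measurable_sinh : measurable_fun [set: RM] (@sinh R : _ -> RM).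
Proof.
apply: measurable_funM => //; apply: measurable_funB => //.
exact: (measurableT_comp (@measurable_expR R)).
Qed.

Lemma cosh_gt0 (r : R) : 0 < cosh r.
Proof. by rewrite divr_gt0// addr_gt0// expR_gt0. Qed.

Let f (p : RM * 'cV[R]_n) := polar_dS p.1 p.2.

Let mf : measurable_fun setT f.
Proof.
apply: measurable_fun_cVP => i; have [j ->|->] := unliftP 0 i.
  rewrite (_ : (fun _ => _) =
      (fun p : RM * 'cV[R]_n => cosh p.1 * p.2 j 0)); last first.
    by apply/funext => p; rewrite /f /polar_dS cons_cVS mxE.
  apply: measurable_funM.
    exact: (measurableT_comp measurable_cosh).
  exact: (measurableT_comp (measurable_coord j)).
rewrite (_ : (fun _ => _) = (fun p : RM * 'cV[R]_n => sinh p.1)).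
  exact: (measurableT_comp measurable_sinh).
by apply/funext => p; rewrite /f /polar_dS cons_cV0.
Qed.

Let dens (A : set (RM * 'cV[R]_n)%type) :=
  (\int[(@lebesgue_measure R \x @sphere_measure R n)]_(p in A)
     (cosh p.1 ^+ n.-1)%:E)%E.

Let dens0 : dens set0 = 0%E. Proof. exact: integral_set0. Qed.

Let dens_ge0 A : (0 <= dens A)%E.
Proof.
by apply: integral_ge0 => p _; rewrite lee_fin exprn_ge0// ltW// cosh_gt0.
Qed.

Let dens_sigma_additive : semi_sigma_additive dens.
Proof.
apply: semi_sigma_additive_nng_induced.
  apply/measurable_EFinP/measurable_funX.
  exact: (measurableT_comp measurable_cosh).
by move=> p; rewrite lee_fin exprn_ge0// ltW// cosh_gt0.
Qed.

HB.instance Definition _ := isMeasure.Build _ _ _ dens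
  dens0 dens_ge0 dens_sigma_additive.

Let mu_dSE : @mu_dS R n = pushforward dens f. Proof. by []. Qed.

Let mu_dS0 : @mu_dS R n set0 = 0%E.
Proof. by rewrite mu_dSE measure0. Qed.

Let mu_dS_ge0 A : (0 <= @mu_dS R n A)%E.
Proof. by rewrite mu_dSE measure_ge0. Qed.

Let mu_dS_sigma_additive : semi_sigma_additive (@mu_dS R n).
Proof. by rewrite mu_dSE; exact: measure_semi_sigma_additive. Qed.

HB.instance Definition _ := isMeasure.Build _ _ _ (@mu_dS R n)
  mu_dS0 mu_dS_ge0 mu_dS_sigma_additive.

End mu_dS_measure.

Definition half_space (R : realType) (n : nat) (u : 'cV[R]_n.+1) :
  set 'cV[R]_n.+1 := [set x | hyperboloid x /\ 0 < minkowski x u].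

Definition half_spaceC (R : realType) (n : nat) (u : 'cV[R]_n.+1) :
  set 'cV[R]_n.+1 := @hyperboloid R n `\` half_space u.

Definition half_spaces (R : realType) (n : nat) : set (set 'cV[R]_n.+1) :=
  @half_space R n @` @deSitter R n `|` @half_spaceC R n @` @deSitter R n.

(* A section is given by the set tau of all u such that half_space u is chosen;
   half_spaceC u is chosen for the other u in de Sitter space. *)
Definition chosen (R : realType) (n : nat) (tau : set 'cV[R]_n.+1) :
    set (set 'cV[R]_n.+1) :=
  @half_space R n @` tau `|` @half_spaceC R n @` (@deSitter R n `\` tau).

Definition admissible (R : realType) (n : nat) (tau : set 'cV[R]_n.+1) : Prop :=
  forall h k, chosen tau h -> half_spaces k -> h `<=` k -> chosen tau k.

Definition point_section (R : realType) (n : nat) (x : 'cV[R]_n.+1) :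
  set 'cV[R]_n.+1 := [set u | deSitter u /\ 0 < minkowski x u].

Definition sections (R : realType) (n : nat) : set (set 'cV[R]_n.+1) :=
  [set tau | [/\ tau `<=` @deSitter R n, measurable tau, admissible tau &
    (mu_dS (tau `+` point_section (origin R n)) < +oo)%E]].

(* SO^+(n, 1) *)
Definition isometry_group (R : realType) (n : nat) : set 'M[R]_n.+1 :=
  [set g | [/\ forall x y, minkowski (g *m x) (g *m y) = minkowski x y,
    \det g = 1 & forall x, hyperboloid x -> hyperboloid (g *m x)]].

(* The choice of g made in the definition of the border function. *)
Definition base_isometry (R : realType) (n : nat) (x : 'cV[R]_n.+1)
    (g : 'M[R]_n.+1) : Prop :=
  [/\ isometry_group g, g *m origin R n = x &
    x = origin R n -> g = 1%:M].

Definition border_function (R : realType) (n : nat) (tau : set 'cV[R]_n.+1)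
    (g : 'M[R]_n.+1) (b : 'cV[R]_n -> R) : Prop :=
  forall w, sphere w ->
    (forall r, r < b w -> tau (g *m polar_dS r w)) /\
    (forall r, b w < r -> ~ tau (g *m polar_dS r w)).

(* Main.v *)
(* Moving the base point from [x] at speed 1 in a direction [e] changes the
   measure of the symmetric difference at the rate
   [- int_S sgn(b(w)) <e,w> dw]: the half-spaces newly separating the moved point
   from [x] have, to first order, width [s |<e,w>|] over [w], and such a
   half-space reduces the distance to [tau] exactly when [b(w)] and [<e,w>] have
   the same sign. At a minimum both [e] and [- e] give a rate [>= 0].
   Differentiation is replaced by two-sided estimates of the separating set at
   distance [s], with an error carried by [|b| <= s], whose measure tends to 0.
   To read [tau] in coordinates centred at [x] one needs the invariance of the
   measure of de Sitter space: it is the cone measure of Lebesgue measure on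
   R^(n+1), which is preserved by matrices of determinant 1. *)
Require Import Defs.
From HB Require Import structures.
From mathcomp Require Import all_boot all_order all_algebra.
From mathcomp Require Import all_classical all_reals all_analysis.
From mathcomp Require Import measurable_realfun ring lra.

Set Implicit Arguments.
Unset Strict Implicit.
Unset Printing Implicit Defensive.

Import Order.TTheory GRing.Theory Num.Theory.
Import numFieldNormedType.Exports.

Local Open Scope classical_set_scope.
Local Open Scope ring_scope.

(** * Linear images of Lebesgue measure *)

(** Let [O] be the section of the base point, [X] the symmetric difference of [O] with the given
    section, and [D] that of [O] with the section of the moved point. Minimality says mu(X) <= mu(X
    + D), with + the symmetric difference; since mu(X) is finite this becomes mu(D & X) <= mu(D -
    X). Over [w], the set [D] consists of the [r] between 0 and artanh(tanh s <e,w>). Squeezing this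
    interval between the lengths tanh(s)|<e,w>| and cosh(s)^2 tanh(s)|<e,w>| puts the factor tanh(s)
    on both sides. It cancels before any limit is taken, and the remaining constant cosh(s)^(n-1)
    cosh(s)^2 tends to 1. For the invariance, the cone carries the weight 1/sqrt(<x,x>). At a fixed
    space part [y] the substitution t = |y| tanh r then leaves the factor 1/cosh r, which is free of
    [y], so the integral over [y] is the volume of a Euclidean cone, which is the surface measure by
    definition. Only one real variable is ever substituted, and no polar Jacobian in R^n is
    computed. *)

Section lebesgue_affine.
Variable R : realType.
Local Notation RM := (measurableTypeR R).
Local Notation mu := (@lebesgue_measure R).

Lemma measurable_affine (c a : R) :
  measurable_fun setT (fun t : RM => c * t + a : RM).
Proof. by apply: measurable_funD => //; exact: measurable_funM. Qed.

(** The pushforward of [mu] under the affine map, multiplied by [c], gives half-open intervals their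
    length, and this characterizes Lebesgue measure. *)
Lemma lebesgue_measure_affine (c a : R) (A : set RM) : 0 < c ->
  measurable A -> mu [set t | A (c * t + a)] = (c^-1%:E * mu A)%E.
Proof.
move=> c0 mA.
have c'0 : 0 <= c by exact: ltW.
pose m := measure_function_pushforward__canonical__measure_function_Measure
  mu (measurable_affine c a).
pose nu : {measure set RM -> \bar R} := mscale (NngNum c'0) m.
have nuE (B : set RM) : nu B = (c%:E * mu [set t | B (c * t + a)%R])%E by [].
have muE : mu A = nu A.
  apply: lebesgue_measure_unique mA => _ [[x y]] _ <-.
  rewrite nuE.
  rewrite (_ : [set t | `]x, y]%classic (c * t + a)] =
      `](x - a) / c, (y - a) / c]%classic); last first.
    apply/seteqP; split=> t /=; rewrite !in_itv/= ltr_pdivrMr// ler_pdivlMr//;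
      by rewrite ltrBlDr lerBrDr ?(mulrC t).
  rewrite !lebesgue_measure_itv /= !lte_fin ltr_pM2r ?invr_gt0// ltrD2r.
  case: ifP => _; last by rewrite mule0.
  rewrite -!EFinD -EFinM; congr EFin.
  by rewrite mulrBr !(mulrC c) !mulfVK ?gt_eqF// opprB addrA subrK.
by rewrite muE nuE muleA -EFinM mulVf ?gt_eqF// mul1e.
Qed.

Lemma ge0_integral_affine (c a : R) (f : RM -> \bar R) : 0 < c ->
  measurable_fun setT f -> (forall t, 0 <= f t)%E ->
  (\int[mu]_t f (c * t + a)%R = c^-1%:E * \int[mu]_t f t)%E.
Proof.
move=> c0 mf f0.
have ci0 : 0 <= c^-1 by rewrite invr_ge0 ltW.
pose m := measure_function_pushforward__canonical__measure_function_Measure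
  mu (measurable_affine c a).
pose nu : {measure set RM -> \bar R} := mscale (NngNum ci0) mu.
transitivity (\int[m]_t f t)%E.
  by rewrite [RHS](ge0_integral_pushforward (measurable_affine c a))// preimage_setT.
transitivity (\int[nu]_t f t)%E; last first.
  exact: (ge0_integral_mscale mu measurableT (NngNum ci0) mf).
have mnu A : measurable A -> m A = nu A by exact: lebesgue_measure_affine.
by apply: eq_measure_integral => A mA _; exact: mnu.
Qed.

End lebesgue_affine.

Section lebesgue_cV_linear.
Variable R : realType.
Local Notation RM := (measurableTypeR R).
Local Notation mu := (@lebesgue_measure R).

Lemma measurable_mulmx m n (A : 'M[R]_(m, n)) :
  measurable_fun setT (fun x : 'cV[R]_n => A *m x).
Proof.
apply: measurable_fun_cVP => i.
under eq_fun do rewrite mxE.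
apply: measurable_sum => j; apply: measurable_funM => //.
exact: measurable_coord.
Qed.

Lemma measurable_cons_cVl n (y : 'cV[R]_n) :
  measurable_fun [set: RM] (fun t => cons_cV t y).
Proof. by apply: (measurableT_comp (@measurable_cons_cV R n) (measurable_pair2 y)). Qed.

Lemma measurable_cons_cVr n (t : R) :
  measurable_fun [set: 'cV[R]_n] (fun y => cons_cV t y).
Proof. by apply: (measurableT_comp (@measurable_cons_cV R n) (measurable_pair1 t)). Qed.

Lemma lebesgue_cVS n (A : set 'cV[R]_n.+1) :
  lebesgue_cV A = (\int[mu]_t lebesgue_cV [set y | A (cons_cV t y)])%E.
Proof.
by apply: eq_integral => t _ /=; congr lebesgue_cV; apply/seteqP; split => y;
  rewrite /xsection /= inE.
Qed.

Lemma measurable_cons_preimage n (A : set 'cV[R]_n.+1) : measurable A ->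
  measurable [set p : RM * 'cV[R]_n | A (cons_cV p.1 p.2)].
Proof.
by move=> mA; rewrite -[X in measurable X]setTI; exact: measurable_cons_cV.
Qed.

(** The definition slices by the first coordinate. Shears that move the first coordinate need the
    lines at fixed [y] instead; both iterated integrals agree on rectangles, hence everywhere. *)
Lemma lebesgue_cVS_swap n (A : set 'cV[R]_n.+1) : measurable A ->
  lebesgue_cV A = (\int[@lebesgue_cV R n]_y mu [set t | A (cons_cV t y)])%E.
Proof.
move=> mA.
have mA' := measurable_cons_preimage mA.
transitivity ((mu \x^ @lebesgue_cV R n)%E
    [set p : RM * 'cV[R]_n | A (cons_cV p.1 p.2)]).
  apply: (product_measure_unique (m1 := mu) (m2 := @lebesgue_cV R n)) mA'.
  by move=> B C mB mC; exact: product_measure2E.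
apply: eq_integral => y _ /=; congr (mu _); apply/seteqP; split => t;
  by rewrite /ysection /= inE.
Qed.

Lemma measurable_fun_cons_section n (A : set 'cV[R]_n.+1) : measurable A ->
  measurable_fun setT (fun t : RM => lebesgue_cV [set y | A (cons_cV t y)]).
Proof.
move=> /measurable_cons_preimage mA.
rewrite (_ : (fun _ => _) = (@lebesgue_cV R n) \o xsection
    [set p : RM * 'cV[R]_n | A (cons_cV p.1 p.2)]).
  exact: measurable_fun_xsection.
apply/funext => t /=; congr lebesgue_cV; apply/seteqP; split => y;
  by rewrite /xsection /= inE.
Qed.

Lemma measurable_cons_section n (A : set 'cV[R]_n.+1) t : measurable A ->
  measurable [set y | A (cons_cV t y)].
Proof.
by move=> mA; rewrite -[X in measurable X]setTI; exact: measurable_cons_cVr.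
Qed.

Lemma add_cons_cV n (s t : R) (x y : 'cV[R]_n) :
  cons_cV s x + cons_cV t y = cons_cV (s + t) (x + y).
Proof. by rewrite /cons_cV raddfD; exact: (@add_col_mx _ 1 n 1). Qed.

Lemma scale_cons_cV n (c t : R) (y : 'cV[R]_n) :
  c *: cons_cV t y = cons_cV (c * t) (c *: y).
Proof. by rewrite /cons_cV -scale_scalar_mx; exact: (@scale_col_mx _ 1 n 1). Qed.

Lemma cons_cVK n (x : 'cV[R]_n.+1) : exists t y, x = cons_cV t y.
Proof.
exists (x 0 0), (dsubmx (x : 'cV[R]_(1 + n))).
apply/matrixP => i j; rewrite ord1; have [k ->|->] := unliftP 0 i.
  by rewrite cons_cVS mxE; congr (x _ _); apply/val_inj.
by rewrite cons_cV0.
Qed.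

Lemma lebesgue_cV_translation n (a : 'cV[R]_n) (A : set 'cV[R]_n) :
  measurable A -> lebesgue_cV [set x | A (x + a)] = lebesgue_cV A.
Proof.
elim: n => [|n IH] in a A *.
  move=> _; congr lebesgue_cV; apply/seteqP.
  by split=> x /=; rewrite (flatmx0 (x + a)) (flatmx0 x).
have [s [b ->]] := cons_cVK a => mA; rewrite !lebesgue_cVS.
transitivity (\int[mu]_t lebesgue_cV [set y | A (cons_cV (1 * t + s) y)])%E.
  apply: eq_integral => t _; rewrite -[RHS](IH b); last exact: measurable_cons_section.
  by congr lebesgue_cV; apply/seteqP; split => y /=; rewrite add_cons_cV mul1r.
rewrite (ge0_integral_affine s ltr01 (measurable_fun_cons_section mA))//.
by rewrite invr1 mul1e.
Qed.

Lemma lebesgue_cV_scale n (c : R) (A : set 'cV[R]_n) : 0 < c ->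
  measurable A -> lebesgue_cV [set x | A (c *: x)] = ((c ^- n)%:E * lebesgue_cV A)%E.
Proof.
move=> c0; elim: n => [|n IH] in A *.
  move=> _; rewrite expr0 invr1 mul1e; congr lebesgue_cV; apply/seteqP.
  by split=> x /=; rewrite (flatmx0 (c *: x)) (flatmx0 x).
move=> mA; rewrite !lebesgue_cVS.
transitivity (\int[mu]_t ((c ^- n)%:E *
    lebesgue_cV [set y | A (cons_cV (c * t + 0)%R y)]))%E.
  apply: eq_integral => t _; rewrite -IH; last exact: measurable_cons_section.
  by congr lebesgue_cV; apply/seteqP; split => y /=; rewrite scale_cons_cV addr0.
rewrite ge0_integralZl//; last 2 first.
- apply: measurableT_comp (measurable_fun_cons_section mA) _.
  exact: measurable_affine.
- by rewrite lee_fin invr_ge0 exprn_ge0// ltW.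
rewrite (ge0_integral_affine 0 c0 (measurable_fun_cons_section mA))//.
by rewrite muleA -EFinM exprS invfM mulrC.
Qed.

(** Stated with preimages, so that it composes along products and says that the pushforward of
    Lebesgue measure is Lebesgue measure, the form used for changing variables. *)
Definition preserves_lebesgue n (M : 'M[R]_n) : Prop :=
  forall A, measurable A -> lebesgue_cV [set x | A (M *m x)] = lebesgue_cV A.

Lemma preserves_lebesgueM n (M N : 'M[R]_n) :
  preserves_lebesgue M -> preserves_lebesgue N -> preserves_lebesgue (M *m N).
Proof.
move=> pM pN A mA; rewrite -(pM A)// -(pN [set x | A (M *m x)]).
  by congr lebesgue_cV; apply/seteqP; split => x /=; rewrite mulmxA.
by rewrite -[X in measurable X]setTI; exact: measurable_mulmx.
Qed.

(** At fixed [y] the shear translates the line of first coordinates by the number [r *m y]. *)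
Lemma preserves_lebesgue_row n (r : 'rV[R]_n) :
  preserves_lebesgue (block_mx 1%:M r 0 1%:M : 'M[R]_(1 + n)).
Proof.
move=> A mA; rewrite lebesgue_cVS_swap; last first.
  by rewrite -[X in measurable X]setTI; exact: measurable_mulmx.
rewrite lebesgue_cVS_swap//; apply: eq_integral => y _.
(* Makes the factor 1^-1 appear, so that the affine formula applies with slope 1. *)
rewrite -[RHS]mul1e -[1%E in RHS]/(1%:E) -[1 in RHS]invr1.
rewrite -(lebesgue_measure_affine ((r *m y) 0 0) ltr01); last first.
  by rewrite -[X in measurable X]setTI; exact: measurable_cons_cVl.
have rE t : block_mx 1%:M r 0 1%:M *m cons_cV t y = cons_cV (1 * t + (r *m y) 0 0) y.
  rewrite mul_block_col !mul1mx mul0mx add0r mul1r /cons_cV.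
  by rewrite (raddfD (@scalar_mx R 1)) /= {1}[r *m y]mx11_scalar.
by congr (mu _); apply/seteqP; split => t /=; rewrite rE.
Qed.

(** At fixed first coordinate [t] the shear translates the slice by [t *: l]. *)
Lemma preserves_lebesgue_col n (l : 'cV[R]_n) :
  preserves_lebesgue (block_mx 1%:M 0 l 1%:M : 'M[R]_(1 + n)).
Proof.
move=> A mA; rewrite [LHS]lebesgue_cVS lebesgue_cVS; apply: eq_integral => t _.
rewrite -[RHS](lebesgue_cV_translation (t *: l)); last exact: measurable_cons_section.
congr lebesgue_cV; apply/seteqP; split => y /=; rewrite mul_block_col !mul1mx mul0mx;
  by rewrite addr0 mul_mx_scalar addrC.
Qed.

Lemma preserves_lebesgue_block n (D : 'M[R]_n) : preserves_lebesgue D ->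
  preserves_lebesgue (block_mx 1%:M 0 0 D : 'M[R]_(1 + n)).
Proof.
move=> pD A mA; rewrite [LHS]lebesgue_cVS lebesgue_cVS; apply: eq_integral => t _.
rewrite -[RHS](pD [set y | A (cons_cV t y)]); last exact: measurable_cons_section.
congr lebesgue_cV; apply/seteqP; split => y /=; rewrite mul_block_col mul1mx !mul0mx;
  by rewrite addr0 add0r.
Qed.

(* Transvections preserve Lebesgue measure by Fubini, and they reduce a matrix
   of determinant 1 to the identity, one row and column at a time. *)
Lemma preserves_lebesgue_det1 n (M : 'M[R]_n) : \det M = 1 ->
  preserves_lebesgue M.
Proof.
elim: n => [|n IH] in M *.
  move=> _ A _; congr lebesgue_cV; apply/seteqP.
  by split=> x /=; rewrite (flatmx0 (M *m x)) (flatmx0 x).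
have det_row (r : 'rV[R]_n) : \det (block_mx 1%:M r 0 1%:M : 'M[R]_(1 + n)) = 1.
  by rewrite det_ublock !det1 mulr1.
have det_col (l : 'cV[R]_n) : \det (block_mx 1%:M 0 l 1%:M : 'M[R]_(1 + n)) = 1.
  by rewrite det_lblock !det1 mulr1.
(* With pivot 1, block elimination writes [N] as a column shear, a block with the Schur complement
   [D - l *m u], and a row shear. The Schur complement has determinant 1, so the induction
   hypothesis applies to it. *)
have step1 (N : 'M[R]_(1 + n)) : \det N = 1 -> N 0 0 = 1 -> preserves_lebesgue N.
  move=> dN N00.
  pose u := ursubmx N; pose l := dlsubmx N; pose D := drsubmx N.
  have NE : N = block_mx 1%:M 0 l 1%:M *m
      (block_mx 1%:M 0 0 (D - l *m u) *m block_mx 1%:M u 0 1%:M).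
    rewrite !mulmx_block !mul1mx !mul0mx !mulmx1 !mulmx0 !addr0 !add0r.
    rewrite addrC subrK -[LHS]submxK.
    congr block_mx; last by rewrite mulmx1.
    rewrite [LHS]mx11_scalar; congr (_%:M); rewrite !mxE -[RHS]N00.
    by congr (N _ _); apply/val_inj.
  rewrite NE; apply: preserves_lebesgueM; first exact: preserves_lebesgue_col.
  apply: preserves_lebesgueM; last exact: preserves_lebesgue_row.
  apply/preserves_lebesgue_block/IH.
  move: dN; rewrite NE !det_mulmx det_col det_row mul1r mulr1.
  by rewrite det_ublock det1 mul1r.
(* A nonzero entry below the corner suffices: adding a multiple of its row to the first row turns
   the corner into 1. *)
have step2 (N : 'M[R]_(1 + n)) i : \det N = 1 -> N (rshift 1 i) 0 != 0 ->
    preserves_lebesgue N.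
  move=> dN Ni0.
  pose r : 'rV[R]_n := ((1 - N 0 0) / N (rshift 1 i) 0) *: delta_mx 0 i.
  have -> : N = block_mx 1%:M (- r) 0 1%:M *m (block_mx 1%:M r 0 1%:M *m N).
    rewrite mulmxA mulmx_block !mul1mx !mul0mx !mulmx1 !mulmx0 !addr0 !add0r.
    by rewrite subrr -scalar_mx_block mul1mx.
  apply: preserves_lebesgueM; first exact: preserves_lebesgue_row.
  apply: step1; first by rewrite det_mulmx det_row dN mulr1.
  rewrite -[N in _ *m N]submxK mulmx_block !mul1mx.
  have -> : (0 : 'I_(1 + n)) = lshift n 0 by apply/val_inj.
  rewrite block_mxEul 2!mxE -scalemxAl -rowE !mxE.
  rewrite (_ : lshift n 0 = 0 :> 'I_(1 + n)); last exact/val_inj.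
  by rewrite divfK// addrC subrK.
move=> dM.
have [/existsP[i Mi0]|] := boolP [exists i : 'I_n, M (rshift 1 i) 0 != 0].
  exact: step2 Mi0.
rewrite negb_exists => /forallP M0.
have l0 : dlsubmx (M : 'M[R]_(1 + n)) = 0.
  apply/matrixP => i j; rewrite !mxE ord1 (_ : lshift n 0 = 0); last exact/val_inj.
  by apply/eqP; have := M0 i; rewrite negbK.
have ME := submxK (M : 'M[R]_(1 + n)); rewrite l0 in ME.
have M00 : ulsubmx (M : 'M[R]_(1 + n)) 0 0 = M 0 0.
  by rewrite !mxE; congr (M _ _); apply/val_inj.
(* The first column now vanishes below the corner, so the determinant factors and the corner is
   nonzero. *)
have dM' : M 0 0 * \det (drsubmx (M : 'M[R]_(1 + n))) = 1.
  have := det_ublock (ulsubmx (M : 'M[R]_(1 + n))) (ursubmx (M : 'M[R]_(1 + n)))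
    (drsubmx (M : 'M[R]_(1 + n))).
  by rewrite ME det_mx11 M00 => <-.
case: n => [|n] in M IH det_row det_col step1 step2 dM M0 l0 ME M00 dM' *.
  by apply: step1 => //; rewrite det_mx00 mulr1 in dM'.
(* Adding the first row to the second copies the nonzero corner below itself, which is the situation
   of [step2]. In size 1 there is no second row, but there the corner already equals the
   determinant. *)
pose l : 'cV[R]_n.+1 := delta_mx 0 0.
have -> : M = block_mx 1%:M 0 (- l) 1%:M *m
    (block_mx 1%:M 0 l 1%:M *m (M : 'M[R]_(1 + n.+1))).
  rewrite mulmxA mulmx_block !mul1mx !mul0mx !mulmx1 !mulmx0 !addr0 !add0r.
  by rewrite addNr -scalar_mx_block mul1mx.
apply: preserves_lebesgueM; first exact: preserves_lebesgue_col.
apply: (step2 _ 0); first by rewrite det_mulmx det_col dM mulr1.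
rewrite -ME mulmx_block !mul1mx !mulmx0 !addr0.
have -> : (0 : 'I_(1 + n.+1)) = lshift n.+1 0 by apply/val_inj.
rewrite block_mxEdl mxE big_ord1 M00 !mxE /= mul1r.
by apply/eqP => M00'; move/eqP: dM'; rewrite M00' mul0r eq_sym oner_eq0.
Qed.

End lebesgue_cV_linear.

(** * Densities and the substitution by tanh *)

Section density.
Local Open Scope ereal_scope.
Context d (T : measurableType d) (R : realType) (mu : {measure set T -> \bar R}).
Variable w : T -> R.
Hypotheses (mw : measurable_fun setT w) (w0 : forall x, (0 <= w x)%R).

Let dens (A : set T) := \int[mu]_(x in A) (w x)%:E.

Let dens0 : dens set0 = 0. Proof. exact: integral_set0. Qed.

Let dens_ge0 A : 0 <= dens A.
Proof. by apply: integral_ge0 => x _; rewrite lee_fin. Qed.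

Let dens_sigma_additive : semi_sigma_additive dens.
Proof. by apply: semi_sigma_additive_nng_induced => //; exact/measurable_EFinP. Qed.

HB.instance Definition _ := isMeasure.Build _ _ _ dens
  dens0 dens_ge0 dens_sigma_additive.

Lemma density_measure : exists nu : {measure set T -> \bar R},
  forall A, nu A = \int[mu]_(x in A) (w x)%:E.
Proof. by exists dens. Qed.

Import HBNNSimple.

(** Both sides are limits along increasing simple functions by monotone convergence; by linearity
    only indicators remain, and for them the identity is [nuE]. *)
Lemma ge0_integral_density (nu : {measure set T -> \bar R}) (f : T -> \bar R) :
  (forall A, measurable A -> nu A = \int[mu]_(x in A) (w x)%:E) ->
  measurable_fun setT f -> (forall x, 0 <= f x) ->
  \int[nu]_x f x = \int[mu]_x (f x * (w x)%:E).
Proof.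
move=> nuE mf f0; pose h := nnsfun_approx measurableT mf.
have mwE : measurable_fun setT (EFin \o w) by exact/measurable_EFinP.
have mh n : measurable_fun setT (EFin \o h n) by exact/measurable_EFinP.
have -> : \int[nu]_x f x = lim (\int[nu]_x (EFin \o h n) x @[n --> \oo]).
  rewrite -monotone_convergence//.
  - apply: eq_integral => x _; apply/esym/cvg_lim => //.
    exact: cvg_nnsfun_approx.
  - by move=> n x _; rewrite lee_fin.
  - by move=> x _ a b ab; rewrite lee_fin; exact/lefP/nd_nnsfun_approx.
have -> : \int[mu]_x (f x * (w x)%:E) =
    lim (\int[mu]_x ((EFin \o h n) x * (w x)%:E) @[n --> \oo]).
  rewrite -monotone_convergence//.
  - apply: eq_integral => x _; apply/esym/cvg_lim => //.
    by apply: cvgeZr => //; exact: cvg_nnsfun_approx.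
  - by move=> n; exact: emeasurable_funM.
  - by move=> n x _; rewrite mule_ge0 ?lee_fin.
  - move=> x _ a b ab; rewrite lee_wpmul2r ?lee_fin//.
    exact/lefP/nd_nnsfun_approx.
suff suf n : \int[nu]_x (EFin \o h n) x = \int[mu]_x ((EFin \o h n) x * (w x)%:E).
  by under eq_fun do rewrite suf.
transitivity (\int[nu]_x
   (\sum_(y \in range (h n)) (y * \1_(h n @^-1` [set y]) x)%:E)).
  by apply: eq_integral => t tE; rewrite /= fimfunE -fsumEFin.
have indich r : measurable_fun setT (fun x => (r * \1_(h n @^-1` [set r]) x)%:E).
  by apply: (measurable_comp measurableT) => //; exact: measurable_funM.
rewrite ge0_integral_fsum//; last by move=> m y Ey; exact: nnfun_muleindic_ge0.
transitivity (\int[mu]_x (\sum_(y \in range (h n))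
    (y * \1_(h n @^-1` [set y]) x)%:E * (w x)%:E)); last first.
  under [RHS]eq_integral => x xE.
    rewrite /= fimfunE -fsumEFin// ge0_mule_fsuml => [|y]; last exact: nnfun_muleindic_ge0.
    over.
  by [].
rewrite ge0_integral_fsum//; last 2 first.
  - by move=> y; apply: emeasurable_funM.
  - by move=> m y Ey; apply: mule_ge0; [exact: nnfun_muleindic_ge0|rewrite lee_fin].
apply: eq_fsbigr => r rhn.
under [LHS]eq_integral do rewrite EFinM.
rewrite integralZl_indic_nnsfun => //.
under [RHS]eq_integral do rewrite EFinM -muleA.
rewrite ge0_integralZl//.
- under [in RHS]eq_integral do rewrite muleC.
  rewrite [in RHS](eq_integral ((EFin \o w) \_ (h n @^-1` [set r]))); last first.
    by move=> x xE; rewrite epatch_indic.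
  by rewrite -integral_mkcond -nuE// integral_indic// setIT.
- apply: emeasurable_funM => //; exact/measurable_EFinP.
- by move=> t Et; rewrite mule_ge0 ?lee_fin.
- by move: rhn; rewrite inE => -[t _ <-]; rewrite lee_fin.
Qed.

End density.

Definition tanh (R : realType) (r : R) : R := sinh r / cosh r.

Definition artanh (R : realType) (z : R) : R := (ln (1 + z) - ln (1 - z)) / 2.

Section tanh.
Variable R : realType.
Local Notation RM := (measurableTypeR R).
Local Notation mu := (@lebesgue_measure R).
Implicit Types r s z : R.

Lemma cosh2B r : cosh r ^+ 2 - sinh r ^+ 2 = 1.
Proof.
have E : expR r * expR (- r) = 1 by rewrite -expRD subrr expR0.
by rewrite /cosh /sinh; field: E.
Qed.

Lemma cosh_neq0 r : cosh r != 0. Proof. by rewrite gt_eqF// cosh_gt0. Qed.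

Lemma cosh_ge1 r : 1 <= cosh r.
Proof.
rewrite -(ler_pXn2r (n := 2))// ?nnegrE ?ler01 ?(ltW (cosh_gt0 _))// expr1n.
by rewrite -[leRHS](subrK (sinh r ^+ 2)) cosh2B lerDl sqr_ge0.
Qed.

Lemma is_derive_sinh r : is_derive r 1 (@sinh R) (cosh r).
Proof.
have -> : @sinh R = (fun x => 2^-1 * (expR x - expR (- x))).
  by apply/funext => x; rewrite /sinh mulrC.
apply: is_derive_eq; rewrite /cosh /GRing.scale /=; by field.
Qed.

Lemma is_derive_cosh r : is_derive r 1 (@cosh R) (sinh r).
Proof.
have -> : @cosh R = (fun x => 2^-1 * (expR x + expR (- x))).
  by apply/funext => x; rewrite /cosh mulrC.
apply: is_derive_eq; rewrite /sinh /GRing.scale /=; by field.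
Qed.

Lemma is_derive_tanh r : is_derive r 1 (@tanh R) (cosh r ^- 2).
Proof.
have dV := is_deriveV (cosh_neq0 r) (is_derive_cosh r).
apply: (is_derive_eq (is_deriveM (is_derive_sinh r) dV)).
rewrite /GRing.scale /=.
have c0 := cosh_neq0 r; have c2 := cosh2B r.
transitivity ((cosh r ^+ 2 - sinh r ^+ 2) / cosh r ^+ 2); last by rewrite c2 mul1r.
by field.
Qed.

Lemma continuous_cosh : continuous (@cosh R).
Proof.
move=> r; apply/differentiable_continuous/derivable1_diffP.
by have [] := is_derive_cosh r.
Qed.

Lemma continuous_tanh : continuous (@tanh R).
Proof.
move=> r; apply/differentiable_continuous/derivable1_diffP.
by have [] := is_derive_tanh r.
Qed.

(** The exponential occurs only once in this form, so the bounds, the monotonicity and the inverse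
    of [tanh] follow from those of [expR]. *)
Lemma tanhE r : tanh r = 1 - 2 / (expR (r * 2) + 1).
Proof.
have e0 : expR r != 0 by rewrite gt_eqF// expR_gt0.
rewrite /tanh /sinh /cosh expRN mulr_natr mulr2n expRD.
have ? : expR r * expR r + 1 != 0.
  by rewrite gt_eqF// ltr_wpDl// mulr_ge0// expR_ge0.
by field; rewrite e0 andbT.
Qed.

Lemma tanh_lt1 r : tanh r < 1.
Proof. by rewrite tanhE gtrBl divr_gt0// addr_gt0// expR_gt0. Qed.

Lemma tanh_gtN1 r : -1 < tanh r.
Proof.
have e0 := expR_gt0 (r * 2); rewrite tanhE ltrBrDr -ltrBrDl opprK.
by rewrite ltr_pdivrMr ?addr_gt0//; nra.
Qed.

Lemma artanhK z : -1 < z -> z < 1 -> tanh (artanh z) = z.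
Proof.
move=> z1 z2; rewrite tanhE /artanh mulfVK// -ln_div ?posrE; [|lra..].
rewrite lnK ?posrE ?divr_gt0; [|lra..].
field; by repeat (apply/andP; split); rewrite ?gt_eqF//; lra.
Qed.

Lemma ltr_tanh2 r s : (tanh r < tanh s) = (r < s).
Proof.
rewrite !tanhE ltrD2l ltrN2 ltr_pM2l// ltf_pV2 ?posrE ?addr_gt0 ?expR_gt0//.
by rewrite ltrD2r ltr_expR ltr_pM2r.
Qed.

Lemma measurable_tanh : measurable_fun setT (@tanh R : RM -> RM).
Proof. exact: continuous_measurable_fun continuous_tanh. Qed.

Lemma measurable_artanh : measurable_fun setT (@artanh R : RM -> RM).
Proof.
apply: measurable_funM => //; apply: measurable_funB;
  apply: (measurableT_comp (@measurable_ln R)).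
  exact: measurable_funD.
exact: measurable_funB.
Qed.

End tanh.

Section tanh_substitution.
Variable R : realType.
Local Notation RM := (measurableTypeR R).
Local Notation mu := (@lebesgue_measure R).
Local Notation sech2 := (fun r : R => cosh r ^- 2).

Lemma continuous_sech2 : continuous (sech2 : R -> R).
Proof.
move=> r; apply: cvgV; first by rewrite expf_neq0// cosh_neq0.
by under eq_fun do rewrite expr2; apply: cvgM; exact: continuous_cosh.
Qed.

Lemma sech2_ge0 (r : R) : 0 <= cosh r ^- 2.
Proof. by rewrite invr_ge0 exprn_ge0// ltW// cosh_gt0. Qed.

Lemma measurable_sech2 : measurable_fun setT (sech2 : RM -> RM).
Proof. exact: continuous_measurable_fun continuous_sech2. Qed.

(** This is the substitution z = tanh r on sets. Both sides, seen as measures in [r], give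
    [tanh b - tanh a] on []a, b]], the right one by the fundamental theorem of calculus, and
    half-open intervals determine a measure that is finite on each []-n, n]]. *)
Lemma lebesgue_measure_tanh (E : set RM) : measurable E ->
  mu (E `&` `]-1, 1[) = (\int[mu]_(r in @tanh R @^-1` E) (cosh r ^- 2)%:E)%E.
Proof.
move=> mE.
have mD : measurable (`]-1, 1[%classic : set RM) by exact: measurable_itv.
(* Restricting [mu] to []-1, 1[] discards the points where [artanh] involves the default value of
   [ln] at a nonpositive number. *)
pose nu := measure_function_pushforward__canonical__measure_function_Measure
  (mrestr mu mD) (@measurable_artanh R).
have nuE (B : set RM) : nu B = mu (@artanh R @^-1` B `&` `]-1, 1[) by [].
have [kap kapE] := density_measure mu measurable_sech2 sech2_ge0.
have nuI (a b : R) : a < b -> nu `]a, b]%classic = (tanh b - tanh a)%:E.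
  move=> ab; rewrite nuE.
  rewrite (_ : _ `&` _ = `]tanh a, tanh b]%classic); last first.
    apply/seteqP; split => z /=; rewrite !in_itv/=.
      by move=> [/andP[az zb] /andP[z1 z2]]; rewrite -(artanhK z1 z2)
        ltr_tanh2 az leNgt ltr_tanh2 -leNgt.
    move=> /andP[az zb].
    have z1 : -1 < z by exact: lt_trans (tanh_gtN1 a) az.
    have z2 : z < 1 by exact: le_lt_trans zb (tanh_lt1 b).
    rewrite z1 z2; split => //; move: az zb; rewrite -{1 2}(artanhK z1 z2) ltr_tanh2.
    by move=> ->; rewrite leNgt ltr_tanh2 -leNgt.
  by rewrite lebesgue_measure_itv/= lte_fin ltr_tanh2 ab.
have kapI (a b : R) : a < b -> kap `]a, b]%classic = (tanh b - tanh a)%:E.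
  move=> ab; rewrite kapE integral_itv_obnd_cbnd; last first.
    by apply/measurable_EFinP/measurable_funTS; exact: measurable_sech2.
  apply: (continuous_FTC2 ab).
  - by apply: continuous_subspaceT; exact: continuous_sech2.
  - split; first by move=> r _; have [] := is_derive_tanh r.
    + exact/cvg_at_right_filter/continuous_tanh.
    + exact/cvg_at_left_filter/continuous_tanh.
  - by move=> r _; rewrite derive1E; have [] := is_derive_tanh r.
have nukap B : measurable B -> nu B = kap B.
  apply: (@measure_unique _ R RM (@ocitv R)
    (fun n => `](- n%:R)%R, n%:R%R]%classic) _ _ _ _ nu kap).
  - by [].
  - exact: ocitvI.
  - by move=> n; exists (- n%:R, n%:R).
  - apply/seteqP; split => // r _.
    exists (Num.truncn `|r|).+1 => //=; rewrite in_itv/=.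
    have := truncnS_gt `|r|; rewrite ltr_norml => /andP[-> h]; exact: ltW.
  - move=> _ [[a b] _ <-] /=; have [ab|ba] := ltP a b; first by rewrite nuI ?kapI.
    have -> : `]a, b]%classic = set0 by rewrite set_itv_ge// bnd_simp -leNgt.
    by rewrite !measure0.
  (* The exhausting intervals must have finite mass; the one of index 0 is empty and is treated
     apart, because [nuI] requires a < b. *)
  - move=> n; case: n => [|n].
      have -> : `](- 0%:R)%R, 0%:R%R]%classic = set0 :> set R.
        by rewrite oppr0 set_itv_ge// bnd_simp ltxx.
      by rewrite measure0.
    by rewrite nuI ?ltry// gtrN.
have mtE : measurable (@tanh R @^-1` E).
  by rewrite -[X in measurable X]setTI; exact: measurable_tanh.
rewrite -kapE -nukap// nuE; congr (mu _); apply/seteqP; split => z [].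
  move=> Ez z1; split => //=; move: z1.
  by rewrite /= in_itv/= => /andP[? ?]; rewrite artanhK.
move=> /= + z1; split => //; move: z1 => /=.
by rewrite in_itv/= => /andP[? ?]; rewrite -(artanhK (z := z)).
Qed.

Lemma ge0_integral_tanh (f : RM -> \bar R) :
  measurable_fun setT f -> (forall z, 0 <= f z)%E ->
  (\int[mu]_(z in `](-1)%R, 1%R[) f z =
   \int[mu]_r (f (tanh r) * (cosh r ^- 2)%:E))%E.
Proof.
move=> mf f0.
have [kap kapE] := density_measure mu measurable_sech2 sech2_ge0.
have mft := measurableT_comp mf (@measurable_tanh R).
rewrite -(ge0_integral_density measurable_sech2 sech2_ge0 (nu := kap) _ mft)//; last first.
  by move=> z; exact: f0.
pose nu := measure_function_pushforward__canonical__measure_function_Measure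
  kap (@measurable_tanh R).
have -> : (\int[mu]_(z in `](-1)%R, 1%R[) f z = \int[nu]_(z in `](-1)%R, 1%R[) f z)%E.
  apply: eq_measure_integral => A mA AS.
  transitivity (mu (A `&` `]-1, 1[)); first by rewrite setIidl.
  by rewrite lebesgue_measure_tanh// -kapE.
rewrite [LHS](ge0_integral_pushforward (@measurable_tanh R))//.
  rewrite (_ : @tanh R @^-1` _ = setT)//; apply/seteqP; split => // r _ /=.
  by rewrite in_itv/= tanh_lt1 tanh_gtN1.
exact: measurable_funTS.
Qed.

(* The substitution [t = rho * tanh r]. *)
Lemma ge0_integral_scaled_tanh (rho : R) (f : RM -> \bar R) : 0 < rho ->
  measurable_fun setT f -> (forall z, 0 <= f z)%E ->
  (forall t, rho <= `|t| -> f t = 0%E) ->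
  (\int[mu]_t f t =
   \int[mu]_r (f (rho * tanh r)%R * (rho * cosh r ^- 2)%:E))%E.
Proof.
move=> rho0 mf f0 fsupp.
have mg : measurable_fun setT (fun z : RM => f (rho * z + 0)).
  exact: measurableT_comp mf (measurable_affine rho 0).
have -> : (\int[mu]_t f t = rho%:E * \int[mu]_z f (rho * z + 0)%R)%E.
  by rewrite ge0_integral_affine// muleA -EFinM divff ?gt_eqF// mul1e.
have -> : (\int[mu]_z f (rho * z + 0)%R =
    \int[mu]_(z in `](-1)%R, 1%R[) f (rho * z + 0)%R)%E.
  rewrite [RHS]integral_mkcond; apply: eq_integral => z _.
  rewrite patchE; case: ifPn => //; rewrite notin_setE /= in_itv/= -ltr_norml.
  move=> /negP; rewrite -leNgt => z1; rewrite addr0 fsupp// normrM.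
  by rewrite gtr0_norm// ler_peMr// ltW.
rewrite ge0_integral_tanh// -ge0_integralZl//; last 3 first.
- apply: emeasurable_funM; first exact: measurableT_comp mg (@measurable_tanh R).
  by apply/measurable_EFinP; exact: measurable_sech2.
- by move=> r _; rewrite mule_ge0// lee_fin sech2_ge0.
- by rewrite lee_fin ltW.
by apply: eq_integral => r _; rewrite addr0 EFinM muleCA.
Qed.

End tanh_substitution.

(** * Invariance of the measure of de Sitter space *)

Section polar.
Variables (R : realType) (n : nat).
Local Notation RM := (measurableTypeR R).
Local Notation mu := (@lebesgue_measure R).
Local Notation Rn := 'cV[R]_n.

Lemma enorm_ge0 (y : Rn) : 0 <= enorm y. Proof. exact: sqrtr_ge0. Qed.

Lemma enormZ (c : R) (y : Rn) : 0 <= c -> enorm (c *: y) = c * enorm y.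
Proof.
move=> c0; rewrite /enorm -{2}(ger0_norm c0) -sqrtr_sqr -sqrtrM ?sqr_ge0//.
by rewrite mulr_sumr; congr Num.sqrt; apply: eq_bigr => i _; rewrite mxE exprMn.
Qed.

Lemma sqr_enorm (y : Rn) : enorm y ^+ 2 = \sum_(i < n) y i 0 ^+ 2.
Proof. by rewrite sqr_sqrtr// sumr_ge0// => i _; exact: sqr_ge0. Qed.

Lemma minkowski_cons (t s : R) (y z : Rn) :
  Defs.minkowski (cons_cV t y) (cons_cV s z) = - (t * s) + \sum_(i < n) y i 0 * z i 0.
Proof.
by rewrite /Defs.minkowski !cons_cV0; congr (_ + _); apply: eq_bigr => i _; rewrite !cons_cVS.
Qed.

Lemma minkowski_cons_sqr (t : R) (y : Rn) :
  Defs.minkowski (cons_cV t y) (cons_cV t y) = enorm y ^+ 2 - t ^+ 2.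
Proof.
by rewrite minkowski_cons sqr_enorm addrC expr2; congr (_ - _).
Qed.

Lemma measurable_polar_dS :
  measurable_fun setT (fun p : RM * Rn => polar_dS p.1 p.2).
Proof.
apply: measurable_fun_cVP => i; have [j ->|->] := unliftP 0 i.
  rewrite (_ : (fun _ => _) = (fun p : RM * Rn => cosh p.1 * p.2 j 0)); last first.
    by apply/funext => p; rewrite /polar_dS cons_cVS mxE.
  apply: measurable_funM; first exact: (measurableT_comp (@measurable_cosh R)).
  exact: (measurableT_comp (@measurable_coord R _ j)).
rewrite (_ : (fun _ => _) = (fun p : RM * Rn => sinh p.1)).
  exact: (measurableT_comp (@measurable_sinh R)).
by apply/funext => p; rewrite /polar_dS cons_cV0.
Qed.

Lemma measurable_polar_dSr (r : R) : measurable_fun setT (fun w : Rn => polar_dS r w).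
Proof. exact: measurableT_comp measurable_polar_dS (measurable_pair1 r). Qed.

Lemma measurable_inv_comp d (T : measurableType d) (f : T -> RM) :
  (forall x, 0 <= f x) -> measurable_fun setT f ->
  measurable_fun setT (fun x => (f x)^-1 : RM).
Proof.
move=> f0 mf; rewrite (_ : (fun _ => _) = (fun x => f x `^ (-1))).
  exact: (measurableT_comp (measurable_powR (-1)) mf).
by apply/funext => x; rewrite powR_inv1.
Qed.

Lemma measurable_sqrt_comp d (T : measurableType d) (f : T -> RM) :
  measurable_fun setT f -> measurable_fun setT (fun x => Num.sqrt (f x) : RM).
Proof.
apply: (@measurableT_comp _ _ _ _ _ _ (@Num.sqrt R : RM -> RM)).
exact: continuous_measurable_fun (@sqrt_continuous R).
Qed.

Lemma measurable_minkowski d (T : measurableType d) (f g : T -> 'cV[R]_n.+1) :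
  measurable_fun setT f -> measurable_fun setT g ->
  measurable_fun setT (fun x => Defs.minkowski (f x) (g x) : RM).
Proof.
move=> mf mg.
have mfi i : measurable_fun setT (fun x => f x i 0 : RM).
  exact: measurableT_comp (measurable_coord i) mf.
have mgi i : measurable_fun setT (fun x => g x i 0 : RM).
  exact: measurableT_comp (measurable_coord i) mg.
apply: measurable_funD; first exact/measurable_funN/(measurable_funM (mfi _) (mgi _)).
by apply: measurable_sum => i; exact: (measurable_funM (mfi _) (mgi _)).
Qed.

Lemma measurable_scale_fun d (T : measurableType d) m (c : T -> RM) (f : T -> 'cV[R]_m) :
  measurable_fun setT c -> measurable_fun setT f ->
  measurable_fun setT (fun x => c x *: f x).
Proof.
move=> mc mf; apply: measurable_fun_cVP => i.
under eq_fun do rewrite mxE.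
by apply: measurable_funM => //; exact: measurableT_comp (measurable_coord i) mf.
Qed.

Lemma measurable_preimage d d' (T : measurableType d) (T' : measurableType d')
  (f : T -> T') (A : set T') : measurable_fun setT f -> measurable A ->
  measurable [set x | A (f x)].
Proof. by move=> mf mA; rewrite -[X in measurable X]setTI; exact: mf. Qed.

Lemma measurable_le_cst (c : R) d (T : measurableType d) (f : T -> RM) :
  measurable_fun setT f -> measurable [set x | f x <= c].
Proof.
move=> mf; rewrite (_ : [set x | _] = [set x | `]-oo, c]%classic (f x)]).
  by apply: measurable_preimage mf _; exact: measurable_itv.
by apply/seteqP; split => x /=; rewrite in_itv.
Qed.

(** The first coordinate is integrated innermost, because the substitution t = |y| tanh r takes
    place at fixed [y]. *)
Lemma ge0_integral_cons (F : 'cV[R]_n.+1 -> \bar R) :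
  measurable_fun setT F -> (forall x, 0 <= F x)%E ->
  (\int[@lebesgue_cV R n.+1]_x F x =
   \int[@lebesgue_cV R n]_y \int[mu]_t F (cons_cV t y))%E.
Proof.
move=> mF F0.
pose m := measure_function_pushforward__canonical__measure_function_Measure
  (mu \x @lebesgue_cV R n)%E (@measurable_cons_cV R n).
have -> : (\int[@lebesgue_cV R n.+1]_x F x = \int[m]_x F x)%E.
  exact: eq_measure_integral.
rewrite [LHS](ge0_integral_pushforward (@measurable_cons_cV R n))// preimage_setT.
rewrite fubini_tonelli2//; last by move=> p; exact: F0.
exact: (measurableT_comp mF (@measurable_cons_cV R n)).
Qed.

Lemma mu_dS_fubini (A : set 'cV[R]_n.+1) : measurable A ->
  mu_dS A = (\int[mu]_r ((cosh r ^+ n.-1)%:E *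
    sphere_measure [set w | A (polar_dS r w)]))%E.
Proof.
move=> mA.
have mB := measurable_preimage measurable_polar_dS mA.
have mcosh : measurable_fun setT (fun p : RM * Rn => (cosh p.1 ^+ n.-1)%:E).
  apply/measurable_EFinP/measurable_funX.
  exact: (measurableT_comp (@measurable_cosh R)).
rewrite /mu_dS integral_mkcond fubini_tonelli1; last 2 first.
- by apply/(measurable_restrictT _ mB); exact: measurable_funTS mcosh.
- move=> p; rewrite patchE; case: ifP => // _.
  by rewrite lee_fin exprn_ge0// ltW// cosh_gt0.
apply: eq_integral => r _; rewrite /fubini_F.
have mBr := measurable_preimage (measurable_polar_dSr r) mA.
rewrite -[in RHS](setIT [set w | _]) -integral_indic// -ge0_integralZl//; last 2 first.
- by apply/measurable_EFinP.
- by rewrite lee_fin exprn_ge0// ltW// cosh_gt0.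
apply: eq_integral => w _; rewrite patchE indicE.
by case: ifPn => [|] h; [rewrite mem_set ?mule1 //; move: h; rewrite inE|
   rewrite memNset ?mule0 //; move: h; rewrite notin_setE].
Qed.

End polar.

Section invariance.
Variables (R : realType) (n : nat).
Local Notation RM := (measurableTypeR R).
Local Notation mu := (@lebesgue_measure R).
Local Notation q x := (Defs.minkowski x x).

Definition lorentz_cone (A : set 'cV[R]_n.+1) : set 'cV[R]_n.+1 :=
  [set x | 0 < q x <= 1 /\ A ((Num.sqrt (q x))^-1 *: x)].

(** For x = t u with u in de Sitter space and t > 0, the weight is 1/t. *)
Definition cone_density (A : set 'cV[R]_n.+1) (x : 'cV[R]_n.+1) : \bar R :=
  ((Num.sqrt (q x))^-1 * \1_(lorentz_cone A) x)%:E.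

Lemma cone_density_ge0 A x : (0 <= cone_density A x)%E.
Proof. by rewrite lee_fin mulr_ge0// invr_ge0 sqrtr_ge0. Qed.

Lemma measurable_cone_density A : measurable A ->
  measurable_fun setT (cone_density A).
Proof.
move=> mA; have mq : measurable_fun setT (fun x : 'cV[R]_n.+1 => q x : RM).
  exact: measurable_minkowski.
have mi : measurable_fun setT (fun x : 'cV[R]_n.+1 => (Num.sqrt (q x))^-1 : RM).
  apply: measurable_inv_comp; first by move=> x; exact: sqrtr_ge0.
  exact: measurable_sqrt_comp.
apply/measurable_EFinP/measurable_funM => //; apply: measurable_indic.
have mD : measurable [set x : 'cV[R]_n.+1 | 0 < q x <= 1].
  rewrite (_ : [set x | _] = [set x : 'cV[R]_n.+1 | `]0, 1]%classic (q x)]).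
    by apply: measurable_preimage mq _; exact: measurable_itv.
  by apply/seteqP; split => x /=; rewrite in_itv.
have ms := measurable_scale_fun mi (@measurable_id _ _ setT).
exact: measurableI mD (measurable_preimage ms mA).
Qed.

(** With t = |y| tanh r one has <x,x> = (|y| / cosh r)^2. The weight is cosh r / |y| and the
    Jacobian |y| / cosh^2 r, so their product 1 / cosh r no longer depends on [y]; the bound <x,x>
    <= 1 turns into |y| <= cosh r. *)
Lemma integral_cone_density_line (A : set 'cV[R]_n.+1) (y : 'cV[R]_n) :
  measurable A ->
  (\int[mu]_t cone_density A (cons_cV t y) = \int[mu]_r ((cosh r)^-1 *
    \1_[set p : RM * 'cV[R]_n | 0 < enorm p.2 <= cosh p.1 /\
         A (polar_dS p.1 ((enorm p.2)^-1 *: p.2))] (r, y))%:E)%E.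
Proof.
move=> mA; have mF := measurableT_comp (measurable_cone_density mA) (measurable_cons_cVl y).
(* For y = 0 the vector is not spacelike, and both integrands vanish identically. *)
have [y0|] := eqVneq (enorm y) 0.
  rewrite !integral0_eq// => [r _|t _].
    by rewrite indicE memNset ?mulr0//= y0 ltxx => -[].
  rewrite /cone_density indicE memNset ?mulr0// /lorentz_cone /= minkowski_cons_sqr y0.
  by rewrite expr0n /= sub0r oppr_gt0 => -[/andP[+ _] _]; rewrite ltNge sqr_ge0.
move=> yn0; have y0 : 0 < enorm y by rewrite lt_neqAle eq_sym yn0 enorm_ge0.
rewrite (ge0_integral_scaled_tanh y0)//; last 2 first.
- by move=> t; exact: cone_density_ge0.
(* Outside |t| < |y| the form is nonpositive, so the range of the substitution covers the whole
   support. *)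
- move=> t yt; rewrite /cone_density indicE memNset ?mulr0// /lorentz_cone /= minkowski_cons_sqr.
  move=> -[/andP[+ _] _]; rewrite subr_gt0 -[t ^+ 2]real_normK ?num_real//.
  by rewrite ltr_pXn2r ?nnegrE ?enorm_ge0// ltNge yt.
apply: eq_integral => r _; rewrite /cone_density -EFinM; congr EFin.
have c0 := cosh_gt0 r; have cn0 := cosh_neq0 r.
have qE : q (cons_cV (enorm y * tanh r) y) = (enorm y / cosh r) ^+ 2.
  rewrite minkowski_cons_sqr /tanh.
  transitivity (enorm y ^+ 2 * (cosh r ^+ 2 - sinh r ^+ 2) / cosh r ^+ 2).
    by field.
  by rewrite cosh2B mulr1 (expr_div_n (enorm y) (cosh r)).
have sqE : Num.sqrt (q (cons_cV (enorm y * tanh r) y)) = enorm y / cosh r.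
  by rewrite qE sqrtr_sqr ger0_norm// divr_ge0// ltW.
have scE : (enorm y / cosh r)^-1 *: cons_cV (enorm y * tanh r) y =
    polar_dS r ((enorm y)^-1 *: y).
  rewrite scale_cons_cV /polar_dS scalerA; congr cons_cV.
    by rewrite /tanh; field; rewrite cn0 yn0.
  by congr (_ *: _); rewrite invf_div.
rewrite sqE !indicE.
have -> : (cons_cV (enorm y * tanh r) y \in lorentz_cone A) =
  ((r, y) \in [set p : RM * 'cV[R]_n | 0 < enorm p.2 <= cosh p.1 /\
         A (polar_dS p.1 ((enorm p.2)^-1 *: p.2))]).
  apply: asbool_equiv_eq; rewrite /lorentz_cone /= sqE scE qE y0 /=.
  have d0 : 0 < enorm y / cosh r by exact: divr_gt0.
  by rewrite exprn_gt0// expr_le1 ?(ltW d0)// ler_pdivrMr// mul1r.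
by field; rewrite cn0 yn0.
Qed.

(* In the coordinates [x = t * polar_dS r w] Lebesgue measure is
   [t^n * cosh(r)^(n-1) dt dr dw]; weighting it by [1/t] on [0 < t <= 1] turns
   the radial factor into [1/n]. *)
Lemma mu_dS_cone (A : set 'cV[R]_n.+1) : (0 < n)%N -> measurable A ->
  mu_dS A = (n%:R%:E * \int[@lebesgue_cV R n.+1]_x cone_density A x)%E.
Proof.
move=> n0 mA.
pose B := [set p : RM * 'cV[R]_n | 0 < enorm p.2 <= cosh p.1 /\
         A (polar_dS p.1 ((enorm p.2)^-1 *: p.2))].
have mnrm d (T : measurableType d) (f : T -> 'cV[R]_n) : measurable_fun setT f ->
    measurable_fun setT (fun x => enorm (f x) : RM).
  exact: measurableT_comp (@measurable_enorm R n).
have mdir d (T : measurableType d) (f : T -> 'cV[R]_n) : measurable_fun setT f ->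
    measurable_fun setT (fun x => (enorm (f x))^-1 *: f x).
  move=> mf; apply: (measurable_scale_fun _ mf); apply: measurable_inv_comp.
    by move=> x; exact: enorm_ge0.
  exact: mnrm.
have mB : measurable B.
  have m0 : measurable [set p : RM * 'cV[R]_n | 0 < enorm p.2].
    rewrite (_ : [set p | _] = ~` [set p : RM * 'cV[R]_n | enorm p.2 <= 0]).
      by apply: measurableC; apply: measurable_le_cst; exact: mnrm.
    by apply/seteqP; split => p /=; rewrite ltNge => /negP.
  have m1 : measurable [set p : RM * 'cV[R]_n | 0 < enorm p.2 <= cosh p.1].
    rewrite (_ : [set p | _] = [set p : RM * 'cV[R]_n | 0 < enorm p.2] `&`
        [set p | enorm p.2 - cosh p.1 <= 0]); last first.
      by apply/seteqP; split => p /=; rewrite subr_le0 => /andP.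
    apply: measurableI m0 _; apply: measurable_le_cst.
    apply: measurable_funB; first exact: mnrm.
    exact: (measurableT_comp (@measurable_cosh R)).
  have mp : measurable_fun setT (fun p : RM * 'cV[R]_n =>
      (p.1, (enorm p.2)^-1 *: p.2)).
    apply/measurable_fun_pairP; split; first exact: measurable_fst.
    exact: (mdir _ _ _ measurable_snd).
  apply: measurableI m1 _.
  exact: measurable_preimage (measurableT_comp (@measurable_polar_dS R n) mp) mA.
have mC : measurable_fun setT (fun r : RM => (cosh r)^-1 : RM).
  by apply: measurable_inv_comp; [move=> r; exact/ltW/cosh_gt0|exact: measurable_cosh].
have mG : measurable_fun setT (fun p : RM * 'cV[R]_n => ((cosh p.1)^-1 * \1_B p)%:E).
  apply/measurable_EFinP/measurable_funM; last exact: measurable_indic.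
  exact: measurableT_comp mC _.
have G0 (p : RM * 'cV[R]_n) : (0 <= ((cosh p.1)^-1 * \1_B p)%:E)%E.
  by rewrite lee_fin mulr_ge0// invr_ge0 ltW// cosh_gt0.
rewrite ge0_integral_cons; last 2 first.
- exact: measurable_cone_density.
- exact: cone_density_ge0.
have -> : (\int[@lebesgue_cV R n]_y \int[mu]_t cone_density A (cons_cV t y) =
    \int[@lebesgue_cV R n]_y \int[mu]_r ((cosh r)^-1 * \1_B (r, y))%:E)%E.
  by apply: eq_integral => y _; exact: integral_cone_density_line.
rewrite -(fubini_tonelli (fun p : RM * 'cV[R]_n => ((cosh p.1)^-1 * \1_B p)%:E))//.
rewrite -ge0_integralZl//; last 2 first.
- exact: (@measurable_fun_fubini_tonelli_F _ _ _ _ _ (@lebesgue_cV R n) _ mG G0).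
- by move=> r _; apply: integral_ge0 => y _; exact: (G0 (r, y)).
rewrite mu_dS_fubini//; apply: eq_integral => r _.
have c0 := cosh_gt0 r.
have mBr := measurable_preimage (measurable_pair1 r) mB.
pose C := [set x : 'cV[R]_n | A (polar_dS r ((enorm x)^-1 *: x)) /\ 0 < enorm x <= 1].
have mCC : measurable C.
  have m1 : measurable [set x : 'cV[R]_n | 0 < enorm x <= 1].
    rewrite (_ : [set x | _] = [set x : 'cV[R]_n | `]0, 1]%classic (enorm x)]).
      by apply: measurable_preimage (@measurable_enorm R n) _; exact: measurable_itv.
    by apply/seteqP; split => x /=; rewrite in_itv.
  have mid := mdir _ _ _ (@measurable_id _ 'cV[R]_n setT).
  have mp := measurableT_comp (@measurable_polar_dSr R n r) mid.
  exact: measurableI (measurable_preimage mp mA) m1.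
have -> : (\int[@lebesgue_cV R n]_y ((cosh r)^-1 * \1_B (r, y))%:E =
    (cosh r)^-1%:E * lebesgue_cV [set y | B (r, y)])%E.
  rewrite -[X in lebesgue_cV X]setIT -integral_indic// -ge0_integralZl//.
  - by apply/measurable_EFinP; exact: measurable_indic.
  - by rewrite lee_fin invr_ge0 ltW.
(* The slice is the unit cone [C] enlarged by [cosh r]. Its volume is cosh(r)^n times that of [C],
   which is the surface measure divided by [n]; the factor 1/cosh r lowers the exponent to n-1. *)
have BC : [set y | B (r, y)] = [set y | C ((cosh r)^-1 *: y)].
  have ci0 : 0 < (cosh r)^-1 by rewrite invr_gt0.
  have dirE (e : R) : ((cosh r)^-1 * e)^-1 * (cosh r)^-1 = e^-1.
    by rewrite invfM invrK mulrAC mulfV ?mul1r// cosh_neq0.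
  apply/seteqP; split => y; rewrite /B /C /= enormZ ?(ltW ci0)// scalerA dirE;
    by rewrite pmulr_rgt0// ler_pdivrMl// mulr1 => -[].
rewrite BC lebesgue_cV_scale ?invr_gt0// exprVn invrK /sphere_measure -/C.
rewrite !muleA -!EFinM; congr ((_)%:E * _)%E.
have -> : cosh r ^+ n = cosh r * cosh r ^+ n.-1 by rewrite -exprS prednK.
by rewrite -mulrA mulKf ?cosh_neq0// mulrC.
Qed.

(** The cone formula involves only the form, which [g] preserves, and Lebesgue measure, which a
    matrix of determinant 1 preserves. *)
Lemma mu_dS_isometry (g : 'M[R]_n.+1) (A : set 'cV[R]_n.+1) : (0 < n)%N ->
  (forall x, q (g *m x) = q x) -> \det g = 1 -> measurable A ->
  mu_dS [set u | A (g *m u)] = mu_dS A.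
Proof.
move=> n0 qg dg mA; have mg := measurable_mulmx g.
rewrite !mu_dS_cone//; last exact: measurable_preimage mg mA.
congr (_ * _)%E.
pose m := measure_function_pushforward__canonical__measure_function_Measure
  (@lebesgue_cV R n.+1) mg.
transitivity (\int[m]_x cone_density A x)%E; last first.
  by apply: eq_measure_integral => S mS _; exact: preserves_lebesgue_det1.
rewrite [RHS](ge0_integral_pushforward mg)//; last 2 first.
- exact: measurable_cone_density.
- by move=> x _; exact: cone_density_ge0.
rewrite preimage_setT; apply: eq_integral => x _.
rewrite /cone_density /= qg; congr (_ * _)%:E; rewrite !indicE; congr (nat_of_bool _)%:R.
by apply: asbool_equiv_eq; rewrite /lorentz_cone /= qg -scalemxAr.
Qed.

End invariance.

(** * Half-spaces separating two nearby points *)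

Section hyperbolic_estimates.
Variable R : realType.
Implicit Types r s : R.

Lemma sinhN r : sinh (- r) = - sinh r.
Proof. by rewrite /sinh opprK -mulNr opprB. Qed.

Lemma coshN r : cosh (- r) = cosh r.
Proof. by rewrite /cosh opprK addrC. Qed.

Lemma tanhN r : tanh (- r) = - tanh r.
Proof. by rewrite /tanh sinhN coshN mulNr. Qed.

Lemma tanh0 : tanh 0 = 0 :> R.
Proof. by rewrite /tanh /sinh oppr0 subrr mul0r mul0r. Qed.

Lemma ler_cosh r s : `|r| <= s -> cosh r <= cosh s.
Proof.
rewrite ler_norml => /andP[h1 h2]; rewrite ler_pM2r ?invr_gt0// -subr_ge0.
(* In this factorization both factors are nonnegative, since -s <= r <= s. *)
have -> : expR s + expR (- s) - (expR r + expR (- r)) =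
    (expR s - expR r) * (1 - expR (- s - r)).
  rewrite mulrBr mulr1 mulrBl -!expRD (_ : s + (- s - r) = - r); last by ring.
  by rewrite (_ : r + (- s - r) = - s); ring.
by rewrite mulr_ge0// subr_ge0 ?ler_expR// -expR0 ler_expR; lra.
Qed.

Lemma tanh_mvt r : 0 <= r -> exists2 c, 0 <= c <= r & tanh r = cosh c ^- 2 * r.
Proof.
move=> r0; have [|//||c] := @MVT_segment R (@tanh R) (fun c => cosh c ^- 2) 0 r.
- by [].
- by move=> x _; exact: is_derive_tanh.
- by apply: continuous_subspaceT; exact: continuous_tanh.
by rewrite in_itv/= tanh0 !subr0 => ? ?; exists c.
Qed.

Lemma ler_tanh r : 0 <= r -> tanh r <= r.
Proof.
move=> r0; have [c _ ->] := tanh_mvt r0.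
by rewrite ler_piMl// invf_le1 ?exprn_gt0 ?cosh_gt0// exprn_ege1// cosh_ge1.
Qed.

(** A converse to [ler_tanh] on [0, s], where the derivative of [tanh] is at least cosh(s)^-2. The
    loss cosh(s)^2 tends to 1 as s tends to 0. *)
Lemma ler_cosh2_tanh r s : 0 <= r -> r <= s -> r <= cosh s ^+ 2 * tanh r.
Proof.
move=> r0 rs; have [c /andP[c0 cr] ->] := tanh_mvt r0.
rewrite mulrA ler_peMl// ler_pdivlMr ?exprn_gt0 ?cosh_gt0// mul1r.
rewrite ler_pXn2r ?nnegrE ?(ltW (cosh_gt0 _))//; apply: ler_cosh.
by rewrite ger0_norm// (le_trans cr).
Qed.

Lemma tanh_gt0 r : 0 < r -> 0 < tanh r.
Proof. by rewrite -[in X in _ -> X]tanh0 ltr_tanh2. Qed.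

(** An interval of length [a] with endpoint 0, on the side given by the sign of [h]. The hypothesis
    on zeros covers directions orthogonal to [e], where set and length both degenerate. *)
Lemma lebesgue_measure_side (a h : R) : 0 <= a -> (h == 0) = (a == 0) ->
  lebesgue_measure [set r : R | `|r| < a /\ 0 < r * h] = a%:E.
Proof.
move=> a0 ha; have [h0|h0|h0] := ltgtP h 0.
- rewrite (_ : [set _ | _] = `]- a, 0[%classic).
    rewrite lebesgue_measure_itv/= lte_fin oppr_lt0 lt_neqAle eq_sym -ha a0.
    by rewrite lt_eqF//= -EFinD add0r opprK.
  apply/seteqP; split => r /=; rewrite in_itv/= nmulr_lgt0//.
    by move=> [ra r0]; rewrite r0 andbT; move: ra; rewrite ltr_norml => /andP[].
  by move=> /andP[ra r0]; split => //; rewrite ltr_norml ra (lt_le_trans r0).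
- rewrite (_ : [set _ | _] = `]0, a[%classic).
    rewrite lebesgue_measure_itv/= lte_fin lt_neqAle eq_sym -ha a0.
    by rewrite gt_eqF//= -EFinD oppr0 addr0.
  apply/seteqP; split => r /=; rewrite in_itv/= pmulr_lgt0//.
    by move=> [ra r0]; rewrite r0 /=; move: ra; rewrite ltr_norml => /andP[].
  by move=> /andP[r0 ra]; split => //; rewrite ltr_norml ra andbT (le_lt_trans _ r0)// oppr_le0.
- have /eqP -> : a == 0 by rewrite -ha h0 eqxx.
  rewrite (_ : [set _ | _] = set0) ?measure0//.
  by apply/seteqP; split => r //= [_]; rewrite h0 mulr0 ltxx.
Qed.

Lemma lebesgue_measure_sidec (a h : R) : 0 <= a -> (h == 0) = (a == 0) ->
  lebesgue_measure [set r : R | `|r| <= a /\ 0 <= r * h] = a%:E.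
Proof.
move=> a0 ha; have [h0|h0|h0] := ltgtP h 0.
- rewrite (_ : [set _ | _] = `[- a, 0]%classic).
    rewrite lebesgue_measure_itv/= lte_fin oppr_lt0 lt_neqAle eq_sym -ha a0.
    by rewrite lt_eqF//= -EFinD add0r opprK.
  apply/seteqP; split => r /=; rewrite in_itv/= nmulr_lge0//.
    by move=> [ra r0]; rewrite r0 andbT; move: ra; rewrite ler_norml => /andP[].
  by move=> /andP[ra r0]; split => //; rewrite ler_norml ra (le_trans r0).
- rewrite (_ : [set _ | _] = `[0, a]%classic).
    rewrite lebesgue_measure_itv/= lte_fin lt_neqAle eq_sym -ha a0.
    by rewrite gt_eqF//= -EFinD oppr0 addr0.
  apply/seteqP; split => r /=; rewrite in_itv/= pmulr_lge0//.
    by move=> [ra r0]; rewrite r0 /=; move: ra; rewrite ler_norml => /andP[].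
  by move=> /andP[r0 ra]; split => //; rewrite ler_norml ra andbT (le_trans _ r0)// oppr_le0.
- have /eqP -> : a == 0 by rewrite -ha h0 eqxx.
  rewrite (_ : [set _ | _] = [set 0]) ?lebesgue_measure_set1//.
  apply/seteqP; split => r /=; first by rewrite normr_le0 => -[/eqP].
  by move=> ->; rewrite normr0 mul0r.
Qed.

End hyperbolic_estimates.

(** * Symmetric differences and iterated integrals *)

Section measure_lemmas.
Local Open Scope ereal_scope.
Variable R : realType.

(** [X] and its symmetric difference with [D] share the piece [X \ D]; removing it leaves [D & X]
    and [D \ X]. Finiteness of [m X] allows the cancellation. *)
Lemma measure_setY_min d (T : measurableType d) (m : {measure set T -> \bar R})
    (X D : set T) : measurable X -> measurable D -> m X < +oo ->
  m X <= m (X `+` D) -> m (D `&` X) <= m (D `\` X).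
Proof.
move=> mX mD Xoo; have mXD : measurable (X `\` D) by exact: measurableD.
have mDX : measurable (D `\` X) by exact: measurableD.
rewrite [X in m X <= _ -> _](_ : _ = (X `\` D) `|` (D `&` X)); last first.
  by rewrite setUC setIC setUIDK.
rewrite measureU//; [|exact: measurableI|]; last first.
  by apply/seteqP; split => // x [[_ nDx] [Dx _]].
rewrite /setY measureU//; last first.
  by apply/seteqP; split => // x [[Xx _] [_ nXx]].
rewrite leeD2lE// ge0_fin_numE//; apply: le_lt_trans Xoo.
by apply: le_measure; rewrite ?inE//; exact: subDsetl.
Qed.

Lemma product_measure_swap d1 d2 (T1 : measurableType d1) (T2 : measurableType d2)
    (m1 : {sigma_finite_measure set T1 -> \bar R})
    (m2 : {sigma_finite_measure set T2 -> \bar R}) (A : set (T1 * T2)) :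
  measurable A ->
  \int[m1]_x m2 [set y | A (x, y)] = \int[m2]_y m1 [set x | A (x, y)].
Proof.
move=> mA; transitivity ((m1 \x m2) A).
  apply: eq_integral => x _ /=; congr (m2 _).
  by apply/seteqP; split => y; rewrite /xsection /= inE.
transitivity ((m1 \x^ m2) A).
  apply: (product_measure_unique (m1 := m1) (m2 := m2)) mA.
  by move=> B C mB mC; exact: product_measure2E.
apply: eq_integral => y _ /=; congr (m1 _).
by apply/seteqP; split => x; rewrite /ysection /= inE.
Qed.

End measure_lemmas.

(** * Point sections in polar coordinates, and measurability of the border function *)

Section sphere.
Variables (R : realType) (n : nat).
Local Notation RM := (measurableTypeR R).
Local Notation mu := (@lebesgue_measure R).
Local Notation Rn := 'cV[R]_n.
Local Notation S := (@sphere R n).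
Local Notation sigma := (@sphere_measure R n).

Lemma measurable_sphere : measurable S.
Proof.
rewrite (_ : S = [set w : Rn | [set 1%R] (enorm w)]) //.
exact: measurable_preimage (@measurable_enorm R n) (measurable_set1 _).
Qed.

Lemma sphere_measure_setI (B : set Rn) : sigma B = sigma (B `&` S).
Proof.
rewrite /sphere_measure; congr (_ * lebesgue_cV _)%E; apply/seteqP.
split => x /= [Bx /andP[x0 x1]]; rewrite x0 x1; split => //; last by case: Bx.
split => //; rewrite /sphere /= enormZ ?invr_ge0 ?enorm_ge0//.
by rewrite mulVf// gt_eqF.
Qed.

Lemma measurable_point_section (p : 'cV[R]_n.+1) : measurable (point_section p).
Proof.
have mq : measurable_fun setT (fun u : 'cV[R]_n.+1 => Defs.minkowski u u : RM).
  exact: measurable_minkowski.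
have mp : measurable_fun setT (fun u : 'cV[R]_n.+1 => Defs.minkowski p u : RM).
  exact: measurable_minkowski.
apply: measurableI; first exact: measurable_preimage mq (measurable_set1 1).
rewrite [X in measurable X](_ : _ = [set u | `]0, +oo[%classic (Defs.minkowski p u)]).
  exact: measurable_preimage mp (measurable_itv _).
by apply/seteqP; split => u /=; rewrite in_itv/= andbT.
Qed.

Lemma polar_dS_deSitter (r : R) (w : Rn) : S w -> deSitter (polar_dS r w).
Proof.
rewrite /sphere /deSitter /= => w1; rewrite minkowski_cons_sqr.
by rewrite enormZ ?(ltW (cosh_gt0 r))// w1 mulr1 cosh2B.
Qed.

Lemma hyperboloid_boost (s : R) (e : Rn) : enorm e = 1 ->
  hyperboloid (cons_cV (cosh s) (sinh s *: e)).
Proof.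
move=> e1; split; last by rewrite cons_cV0 cosh_gt0.
rewrite minkowski_cons_sqr sqr_enorm.
under eq_bigr do rewrite mxE exprMn.
by rewrite -mulr_sumr -sqr_enorm e1 expr1n mulr1 -(cosh2B s) opprB.
Qed.

(** The form factors as cosh(s) cosh(r) (tanh(s) <e,w> - tanh(r)), and the first two factors are
    positive. *)
Lemma boost_section (s r : R) (e w : Rn) : S w ->
  point_section (cons_cV (cosh s) (sinh s *: e)) (polar_dS r w) <->
  tanh r < tanh s * \sum_(i < n) e i 0 * w i 0.
Proof.
move=> Sw; have cr := cosh_gt0 r; have cs := cosh_gt0 s.
set h := \sum_(i < n) _.
have E : Defs.minkowski (cons_cV (cosh s) (sinh s *: e)) (polar_dS r w) =
    (cosh s * cosh r) * (tanh s * h - tanh r).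
  rewrite minkowski_cons.
  under eq_bigr do rewrite !mxE mulrACA.
  rewrite -mulr_sumr -/h /tanh; field.
  by rewrite !cosh_neq0.
have c0 : 0 < cosh s * cosh r by exact: mulr_gt0.
split=> [[_]|H]; first by rewrite E (pmulr_rgt0 _ c0) subr_gt0.
split; first exact: polar_dS_deSitter.
by rewrite E (pmulr_rgt0 _ c0) subr_gt0.
Qed.

Lemma origin_section (r : R) (w : Rn) : S w ->
  point_section (origin R n) (polar_dS r w) <-> r < 0.
Proof.
(* The origin is the point at distance s = 0, written with the zero direction. *)
move=> Sw; have := boost_section 0 r 0 Sw.
by rewrite scaler0 tanh0 mul0r -[in X in _ <-> X]tanh0 ltr_tanh2 /cosh oppr0 expR0 divff.
Qed.

Section border.
Variables (T : set 'cV[R]_n.+1) (b : Rn -> R).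
Hypothesis mT : measurable T.
Hypothesis Tlt : forall w, S w -> forall r, r < b w -> T (polar_dS r w).
Hypothesis Tgt : forall w, S w -> forall r, b w < r -> ~ T (polar_dS r w).

(** Measurability of [b] is extracted from that of [T], by testing membership at fixed radii.
    Whether the point at r = b(w) belongs to [T] is left open, hence the test radii c + 1/(k+1)
    strictly above [c]. *)
Lemma measurable_border_gt c : measurable [set w | S w /\ c < b w].
Proof.
rewrite (_ : [set _ | _] =
    \bigcup_k (S `&` [set w | T (polar_dS (c + k.+1%:R^-1) w)])).
  apply: bigcup_measurable => k _; apply: measurableI; first exact: measurable_sphere.
  exact: measurable_preimage (measurable_polar_dSr _) mT.
apply/seteqP; split => w.
  move=> [Sw cb]; have /ltr_add_invr[k hk] := cb.
  by exists k => //; split => //; exact: Tlt.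
move=> [k _ [Sw Tw]]; split => //; rewrite ltNge; apply/negP => bc.
by apply: Tgt Tw => //; rewrite (le_lt_trans bc)// ltrDl.
Qed.

Lemma measurable_border_lt c : measurable [set w | S w /\ b w < c].
Proof.
rewrite (_ : [set _ | _] =
    \bigcup_k (S `\` [set w | T (polar_dS (c - k.+1%:R^-1) w)])).
  apply: bigcup_measurable => k _; apply: measurableD; first exact: measurable_sphere.
  exact: measurable_preimage (measurable_polar_dSr _) mT.
apply/seteqP; split => w.
  move=> [Sw bc]; have /ltr_add_invr[k hk] := bc.
  by exists k => //; split => //; apply: Tgt => //; rewrite ltrBrDr.
move=> [k _ [Sw Tw]]; split => //; rewrite ltNge; apply/negP => cb.
by apply: Tw; apply: Tlt => //; rewrite (lt_le_trans _ cb)// gtrBl.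
Qed.

Lemma measurable_border_small c : measurable [set w | S w /\ `|b w| <= c].
Proof.
rewrite (_ : [set _ | _] =
    S `\` ([set w | S w /\ c < b w] `|` [set w | S w /\ b w < - c])).
  apply: measurableD; first exact: measurable_sphere.
  by apply: measurableU; [exact: measurable_border_gt|exact: measurable_border_lt].
apply/seteqP; split => w.
  move=> [Sw]; rewrite ler_norml => /andP[h1 h2]; split => // -[[_]|[_]].
    by rewrite ltNge h2.
  by rewrite ltNge h1.
move=> [Sw h]; split => //; rewrite ler_norml !leNgt; apply/andP.
by split; apply/negP => ?; apply: h; [right|left].
Qed.

(** Continuity from above for a finite measure: the sets decrease to the zero set of [b]. *)
Lemma border_small_cvg0 : sigma [set w | S w /\ b w = 0] = 0%E ->
  sigma [set w | S w /\ `|b w| <= k.+1%:R^-1] @[k --> \oo] --> 0%E.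
Proof.
move=> b0.
pose F (k : nat) := [set w | S w /\ `|b w| <= k.+1%:R^-1].
have -> : 0%E = sigma (\bigcap_k F k).
  rewrite -b0; congr sigma; apply/seteqP; split => w.
    by move=> [Sw bw] k _; split => //; rewrite bw normr0 invr_ge0.
  move=> h; have [Sw _] := h 0 I; split => //; apply/eqP; rewrite -normr_eq0.
  rewrite eq_le normr_ge0 andbT leNgt; apply/negP => /ltr_add_invr[k].
  by rewrite add0r ltNge; have [_ ->] := h k I.
apply: nonincreasing_cvg_mu => //.
- by rewrite -ge0_fin_numE// fin_num_measure//; exact: measurable_border_small.
- by move=> k; exact: measurable_border_small.
- by apply: bigcap_measurable => // k _; exact: measurable_border_small.
- apply/nonincreasing_seqP => k; apply/subsetPset => w [Sw h]; split => //.
  by apply: (le_trans h); rewrite lef_pV2 ?posrE// ler_nat.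
Qed.

End border.

End sphere.

(** * First-order balance at the origin in one direction [e] *)

Section balance.
Variables (R : realType) (n : nat).
Local Notation RM := (measurableTypeR R).
Local Notation mu := (@lebesgue_measure R).
Local Notation Rn := 'cV[R]_n.
Local Notation S := (@sphere R n).
Local Notation sigma := (@sphere_measure R n).
Variables (T : set 'cV[R]_n.+1) (b : Rn -> R) (e : Rn).
Hypothesis mT : measurable T.
Hypothesis Tlt : forall w, S w -> forall r, r < b w -> T (polar_dS r w).
Hypothesis Tgt : forall w, S w -> forall r, b w < r -> ~ T (polar_dS r w).
Hypothesis e1 : enorm e = 1.

(** A variable tied to the inner product by [hE], so that it can later be instantiated directly by a
    coordinate and by its opposite. *)
Variable h : Rn -> R.
Hypothesis hE : forall w, h w = \sum_(i < n) e i 0 * w i 0.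
Hypothesis h_le1 : forall w, S w -> `|h w| <= 1.

Local Notation O := (point_section (origin R n)).
Local Notation boost s := (point_section (cons_cV (cosh s) (sinh s *: e))).
Local Notation agree := [set w | S w /\ 0 < b w * h w].
Local Notation differ := [set w | S w /\ b w * h w < 0].
Local Notation small s := [set w | S w /\ `|b w| <= s].

Let mh : measurable_fun setT (h : Rn -> RM).
Proof.
rewrite (funext hE); apply: measurable_sum => i; apply: measurable_funM => //.
exact: measurable_coord.
Qed.

Let mnh : measurable_fun setT (fun w : Rn => `|h w| : RM).
Proof. exact: measurableT_comp mh. Qed.

Let mh_gt0 : measurable [set w : Rn | 0 < h w].
Proof.
rewrite (_ : [set _ | _] = ~` [set w | h w <= 0]).
  by apply: measurableC; exact: measurable_le_cst.
by apply/seteqP; split => w /=; rewrite ltNge => /negP.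
Qed.

Let mh_lt0 : measurable [set w : Rn | h w < 0].
Proof.
rewrite (_ : [set _ | _] = ~` [set w | - h w <= 0]).
  by apply: measurableC; apply: measurable_le_cst; exact: measurable_funN.
by apply/seteqP; split => w /=; rewrite oppr_le0 ltNge => /negP.
Qed.

Let mgt := measurable_border_gt mT Tlt Tgt.
Let mlt := measurable_border_lt mT Tlt Tgt.
Let msmall := measurable_border_small mT Tlt Tgt.

Lemma measurable_agree : measurable agree.
Proof.
rewrite (_ : agree = ([set w | S w /\ 0 < b w] `&` [set w | 0 < h w]) `|`
    ([set w | S w /\ b w < 0] `&` [set w | h w < 0])).
  by apply: measurableU; exact: measurableI.
apply/seteqP; split => w /=.
  move=> [Sw]; have [b0|b0|->] := ltgtP (b w) 0; last by rewrite mul0r ltxx.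
    by rewrite nmulr_rgt0// => h0; right.
  by rewrite pmulr_rgt0// => h0; left.
by move=> [[[Sw b0] h0]|[[Sw b0] h0]]; split => //; [exact: mulr_gt0|rewrite nmulr_rgt0].
Qed.

Lemma measurable_differ : measurable differ.
Proof.
rewrite (_ : differ = ([set w | S w /\ 0 < b w] `&` [set w | h w < 0]) `|`
    ([set w | S w /\ b w < 0] `&` [set w | 0 < h w])).
  by apply: measurableU; exact: measurableI.
apply/seteqP; split => w /=.
  move=> [Sw]; have [b0|b0|->] := ltgtP (b w) 0; last by rewrite mul0r ltxx.
    by rewrite nmulr_rlt0// => h0; right.
  by rewrite pmulr_rlt0// => h0; left.
by move=> [[[Sw b0] h0]|[[Sw b0] h0]]; split => //; [rewrite pmulr_rlt0|rewrite nmulr_rlt0].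
Qed.

(** Here 0 < |r| < s < |b(w)|, and [r], [h w], [b w] have the same sign. So [r] lies strictly
    between 0 and the border, where [T] and [O] differ, and also between 0 and the border of the
    moved point, by tanh |r| <= |r|. *)
Lemma boost_sub_symdiff (s r : R) (w : Rn) : 0 < s -> S w ->
  0 < b w * h w -> s < `|b w| -> `|r| < tanh s * `|h w| -> 0 < r * h w ->
  ((O `+` boost s) `&` (T `+` O)) (polar_dS r w).
Proof.
move=> s0 Sw bh sb rh r0.
have t0 := tanh_gt0 s0; have ts := ler_tanh (ltW s0).
have hw := h_le1 Sw.
have rs : `|r| < s.
  apply: (lt_le_trans rh); apply: (le_trans _ ts).
  by rewrite ler_piMr// ltW.
have HO := origin_section r Sw; have HB := boost_section s r e Sw.
rewrite -hE in HB.
have [h0|h0|h0] := ltgtP (h w) 0; last by rewrite h0 mulr0 ltxx in r0.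
  rewrite nmulr_lgt0// in r0; rewrite nmulr_lgt0// in bh.
  rewrite !ltr0_norm// in sb rs rh.
  have rO : O (polar_dS r w) by apply/HO.
  have rB : ~ boost s (polar_dS r w).
    move/HB; rewrite ltNge; apply/negP/negPn.
    have r0N : 0 <= - r by rewrite oppr_ge0 ltW.
    have := ler_tanh r0N; rewrite tanhN.
    by move=> H; rewrite mulrN in rh; lra.
  have rT : ~ T (polar_dS r w) by apply: Tgt => //; lra.
  by split; [left|right].
rewrite pmulr_lgt0// in r0; rewrite pmulr_lgt0// in bh.
rewrite !gtr0_norm// in sb rs rh.
have rO : ~ O (polar_dS r w) by move/HO; rewrite ltNge ltW.
have rB : boost s (polar_dS r w).
  by apply/HB; apply: le_lt_trans rh; exact/ler_tanh/ltW.
have rT : T (polar_dS r w) by apply: Tlt => //; lra.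
by split; [right|left].
Qed.

(** Membership in the first difference puts [r] between 0 and artanh(tanh s h(w)), which gives the
    bounds. As [T] and [O] agree at [r], the border cannot lie strictly beyond [r] on the side of
    [h w]: it lies strictly on the other side of 0, or satisfies |b(w)| <= |r| <= s. *)
Lemma boost_diff_symdiff (s r : R) (w : Rn) : 0 < s -> S w ->
  ((O `+` boost s) `\` (T `+` O)) (polar_dS r w) ->
  [/\ `|r| <= s, (differ `|` small s) w,
      `|r| <= cosh s ^+ 2 * tanh s * `|h w| & 0 <= r * h w].
Proof.
move=> s0 Sw [D X].
have t0 := tanh_gt0 s0; have hw := h_le1 Sw.
have c0 : 0 < cosh s ^+ 2 by rewrite exprn_gt0// cosh_gt0.
have HO := origin_section r Sw; have HB := boost_section s r e Sw.
rewrite -hE in HB.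
case: D => [[rO rB]|[/HB rB rO]].
  have r0 : r < 0 by apply/HO.
  have rT : T (polar_dS r w) by apply: contrapT => nT; apply: X; right.
  have th : tanh s * h w <= tanh r by rewrite leNgt; apply/negP => /HB.
  have tr0 : tanh r < 0 by rewrite -[X in _ < X](tanh0 R) ltr_tanh2.
  have h0 : h w < 0 by rewrite -(pmulr_rlt0 _ t0); exact: le_lt_trans tr0.
  rewrite ltr0_norm// in hw.
  have rs : - r <= s.
    rewrite leNgt -ltr_tanh2 tanhN -leNgt; apply: (@le_trans _ _ (tanh s * - h w)).
      by rewrite mulrN lerN2.
    by rewrite ler_piMr// ltW.
  have rb : r <= b w by rewrite leNgt; apply/negP => /(Tgt Sw).
  split.
  - by rewrite ltr0_norm.
  - have [b0|b0] := ltP 0 (b w); first by left; split => //; rewrite pmulr_rlt0.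
    by right; split => //; rewrite ler0_norm//; lra.
  - rewrite !ltr0_norm// -mulrA mulrN; apply: (le_trans (ler_cosh2_tanh _ rs)); first by lra.
    by rewrite ler_pM2l// tanhN lerN2.
  - by rewrite nmulr_lge0// ltW.
have r0 : 0 <= r by rewrite leNgt; apply/negP => /HO.
have rT : ~ T (polar_dS r w) by move=> rT; apply: X; left.
have tr0 : 0 <= tanh r by rewrite -[X in X <= _](tanh0 R) leNgt ltr_tanh2 -leNgt.
have h0 : 0 < h w by rewrite -(pmulr_rgt0 _ t0); exact: le_lt_trans rB.
rewrite gtr0_norm// in hw.
have rs : r <= s.
  apply/ltW; rewrite -ltr_tanh2; apply: (lt_le_trans rB).
  by rewrite ler_piMr// ltW.
have rb : b w <= r by rewrite leNgt; apply/negP => /(Tlt Sw).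
split.
- by rewrite ger0_norm.
- have [b0|b0] := ltP (b w) 0; first by left; split => //; rewrite nmulr_rlt0.
  by right; split => //; rewrite ger0_norm//; lra.
- rewrite ger0_norm// gtr0_norm// -mulrA; apply: (le_trans (ler_cosh2_tanh r0 rs)).
  by rewrite ler_pM2l// ltW.
- by rewrite pmulr_lge0.
Qed.


(** The strip over [B] between r = 0 and r = s h(w). The open version serves the lower bound and the
    closed one, [sidec], the upper bound; both have measure [s] times the weight of [B]. *)
Let side (s : R) (B : set Rn) : set (RM * Rn) :=
  [set p | B p.2 /\ `|p.1| < s * `|h p.2| /\ 0 < p.1 * h p.2].

Let sidec (s : R) (B : set Rn) : set (RM * Rn) :=
  [set p | B p.2 /\ `|p.1| <= s * `|h p.2| /\ 0 <= p.1 * h p.2].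

Let mprod : measurable_fun setT (fun p : RM * Rn => p.1 * h p.2 : RM).
Proof.
apply: measurable_funM; first exact: measurable_fst.
exact: measurableT_comp mh measurable_snd.
Qed.

Let mgap (s : R) : measurable_fun setT (fun p : RM * Rn => s * `|h p.2| - `|p.1| : RM).
Proof.
apply: measurable_funB.
  by apply: measurable_funM => //; exact: measurableT_comp mnh measurable_snd.
exact: measurableT_comp measurable_fst.
Qed.

Let mside s B : measurable B -> measurable (side s B).
Proof.
move=> mB; apply: measurableI; first exact: measurable_preimage measurable_snd mB.
rewrite [X in measurable X](_ : _ =
    ~` [set p : RM * Rn | s * `|h p.2| - `|p.1| <= 0] `&`
    ~` [set p : RM * Rn | p.1 * h p.2 <= 0]).
  by apply: measurableI; apply: measurableC; apply: measurable_le_cst.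
apply/seteqP; split => p /=; rewrite subr_le0 !leNgt.
  by move=> [-> ->].
by move=> [/negP/negPn ? /negP/negPn].
Qed.

Let msidec s B : measurable B -> measurable (sidec s B).
Proof.
move=> mB; apply: measurableI; first exact: measurable_preimage measurable_snd mB.
rewrite [X in measurable X](_ : _ =
    [set p : RM * Rn | - (s * `|h p.2| - `|p.1|) <= 0] `&`
    [set p : RM * Rn | - (p.1 * h p.2) <= 0]).
  by apply: measurableI; apply: measurable_le_cst;
    [exact: measurable_funN (mgap s)|exact: measurable_funN mprod].
by apply/seteqP; split => p /=; rewrite !oppr_le0 subr_ge0.
Qed.

Let measurable_sphere_section (A : set (RM * Rn)) : measurable A ->
  measurable_fun setT (fun r : RM => sigma [set w | A (r, w)]).
Proof.
move=> mA; rewrite (_ : (fun _ => _) = sigma \o xsection A).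
  exact: measurable_fun_xsection.
apply/funext => r /=; congr sigma; apply/seteqP; split => w;
  by rewrite /xsection /= inE.
Qed.

Let weight (B : set Rn) : \bar R := (\int[sigma]_(w in B) `|h w|%:E)%E.

Let weight_scale (s : R) (B : set Rn) : 0 <= s -> measurable B ->
  (s%:E * weight B = \int[sigma]_w (s * `|h w| * \1_B w)%:E)%E.
Proof.
move=> s0 mB; rewrite /weight integral_mkcond -ge0_integralZl//; last 2 first.
- apply/(measurable_restrictT _ mB)/measurable_funTS; exact/measurable_EFinP.
- by move=> w _; rewrite patchE; case: ifP => // _; rewrite lee_fin.
apply: eq_integral => w _; rewrite patchE indicE.
case: ifPn => _; first by rewrite mulr1 EFinM.
by rewrite [X in (_ * X)%:E](_ : _ = 0)// mulr0 mule0.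
Qed.

Let norm_eq0 (s x : R) : 0 < s -> (x == 0) = (s * `|x| == 0).
Proof. by move=> s0; rewrite mulf_eq0 normr_eq0 (gt_eqF s0). Qed.

Let side_measure s B : 0 < s -> measurable B ->
  (\int[mu]_r sigma [set w | side s B (r, w)] = s%:E * weight B)%E.
Proof.
move=> s0 mB; rewrite (product_measure_swap mu sigma (mside s mB)).
rewrite weight_scale// ?ltW//; apply: eq_integral => w _; rewrite indicE.
have [Bw|Bw] := boolP (w \in B).
  have a0 : 0 <= s * `|h w| by rewrite mulr_ge0// ltW.
  rewrite mulr1 -(lebesgue_measure_side a0 (norm_eq0 (h w) s0)).
  by congr (mu _); apply/seteqP; split => r /=; [case|split; [rewrite inE in Bw|]].
rewrite mulr0 (_ : [set _ | _] = set0) ?measure0//.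
by apply/seteqP; split => r // [Bw']; move: Bw; rewrite notin_setE.
Qed.

Let sidec_measure s B : 0 < s -> measurable B ->
  (\int[mu]_r sigma [set w | sidec s B (r, w)] = s%:E * weight B)%E.
Proof.
move=> s0 mB; rewrite (product_measure_swap mu sigma (msidec s mB)).
rewrite weight_scale// ?ltW//; apply: eq_integral => w _; rewrite indicE.
have [Bw|Bw] := boolP (w \in B).
  have a0 : 0 <= s * `|h w| by rewrite mulr_ge0// ltW.
  rewrite mulr1 -(lebesgue_measure_sidec a0 (norm_eq0 (h w) s0)).
  by congr (mu _); apply/seteqP; split => r /=; [case|split; [rewrite inE in Bw|]].
rewrite mulr0 (_ : [set _ | _] = set0) ?measure0//.
by apply/seteqP; split => r // [Bw']; move: Bw; rewrite notin_setE.
Qed.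

Let mD s : measurable (O `+` boost s).
Proof. by apply: measurableU; apply: measurableD; exact: measurable_point_section. Qed.

Let mX : measurable (T `+` O).
Proof. by apply: measurableU; apply: measurableD => //; exact: measurable_point_section. Qed.

Let mpolar_section (A : set 'cV[R]_n.+1) : measurable A ->
  measurable_fun setT (fun r : RM => sigma [set w | A (polar_dS r w)]).
Proof.
move=> mA.
exact: measurable_sphere_section (measurable_preimage (@measurable_polar_dS R n) mA).
Qed.

Let mcoshn : measurable_fun setT (fun r : RM => (cosh r ^+ n.-1)%:E).
Proof. by apply/measurable_EFinP/measurable_funX; exact: measurable_cosh. Qed.

(** Each point of the open strip of slope tanh(s) is gained, by [boost_sub_symdiff]; the density
    cosh(r)^(n-1) >= 1 is dropped. *)
Lemma weight_le_mu_dS (s : R) : 0 < s ->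
  ((tanh s)%:E * weight (agree `\` small s) <=
   mu_dS ((O `+` boost s) `&` (T `+` O)))%E.
Proof.
move=> s0; have t0 := tanh_gt0 s0.
have mG : measurable (agree `\` small s) by apply: measurableD => //; exact: measurable_agree.
have mDX := measurableI _ _ (mD s) mX.
rewrite -side_measure// mu_dS_fubini//; apply: ge0_le_integral => //.
- exact: measurable_sphere_section (mside _ mG).
- by apply: emeasurable_funM => //; exact: mpolar_section.
move=> r _; rewrite -[leLHS]mul1e; apply: lee_pmul => //.
  by rewrite lee_fin exprn_ege1// cosh_ge1.
apply: le_measure; rewrite ?inE.
- exact: measurable_preimage (measurable_pair1 r) (mside _ mG).
- exact: measurable_preimage (measurable_polar_dSr r) mDX.
move=> w [[[Sw bh] nsm] [rh r0]]; apply: boost_sub_symdiff => //.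
by rewrite ltNge; apply/negP => bs; apply: nsm.
Qed.

(** All directions with |b| <= s are counted as possible losses. The constant is the largest density
    on |r| <= s times the slope cosh(s)^2 tanh(s) of a closed strip containing the lost part. *)
Lemma mu_dS_le_weight (s : R) : 0 < s ->
  (mu_dS ((O `+` boost s) `\` (T `+` O)) <=
   (cosh s ^+ n.-1 * (cosh s ^+ 2 * tanh s))%:E * weight (differ `|` small s))%E.
Proof.
move=> s0; have t0 := tanh_gt0 s0; have c0 := cosh_gt0 s.
have k0 : 0 < cosh s ^+ 2 * tanh s by rewrite mulr_gt0// exprn_gt0.
have mB : measurable (differ `|` small s) by apply: measurableU => //; exact: measurable_differ.
have mDX := measurableD (mD s) mX.
have cn0 : (0 <= (cosh s ^+ n.-1)%:E)%E by rewrite lee_fin exprn_ge0// ltW.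
have ms := measurable_sphere_section (msidec (cosh s ^+ 2 * tanh s) mB).
rewrite EFinM -muleA -sidec_measure// -ge0_integralZl// mu_dS_fubini//.
apply: ge0_le_integral => //.
- by move=> r _; rewrite mule_ge0// lee_fin exprn_ge0// ltW// cosh_gt0.
- by apply: emeasurable_funM => //; exact: mpolar_section.
- exact: emeasurable_funM.
move=> r _; have [rs|sr] := leP `|r| s; last first.
  (* Slices are taken in all of R^n; once cut to the sphere, they are empty for |r| > s. *)
  rewrite sphere_measure_setI [X in sigma X](_ : _ = set0) ?measure0 ?mule0 ?mule_ge0//.
  apply/seteqP; split => w // [DX Sw].
  by have [+ _ _ _] := boost_diff_symdiff s0 Sw DX; rewrite leNgt sr.
apply: lee_pmul => //; first by rewrite lee_fin exprn_ge0// ltW// cosh_gt0.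
  rewrite lee_fin lerXn2r ?nnegrE ?(ltW (cosh_gt0 _))//; exact: ler_cosh.
rewrite sphere_measure_setI; apply: le_measure; rewrite ?inE.
- apply: measurableI; last exact: measurable_sphere.
  exact: measurable_preimage (measurable_polar_dSr r) mDX.
- exact: measurable_preimage (measurable_pair1 r) (msidec _ mB).
by move=> w [DX Sw]; have [_ Bw rh r0] := boost_diff_symdiff s0 Sw DX.
Qed.

Hypothesis T_fin : (mu_dS (T `+` O) < +oo)%E.
Hypothesis T_min : forall p, hyperboloid p ->
  (mu_dS (T `+` O) <= mu_dS (T `+` point_section p))%E.
Hypothesis b0_null : sigma [set w | S w /\ b w = 0] = 0%E.

(** Minimality compares gain and loss; the common factor tanh(s) > 0 of the two bounds cancels,
    which is the division by [s] in a difference quotient. *)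
Lemma weight_agree_le_small (s : R) : 0 < s ->
  (weight (agree `\` small s) <=
   (cosh s ^+ n.-1 * cosh s ^+ 2)%:E * weight (differ `|` small s))%E.
Proof.
move=> s0; have t0 := tanh_gt0 s0.
have H : (mu_dS ((O `+` boost s) `&` (T `+` O)) <=
    mu_dS ((O `+` boost s) `\` (T `+` O)))%E.
  apply: measure_setY_min => //.
  (* Adding [O + boost s] to [T + O] cancels [O] and leaves the symmetric difference of [T] with the
     moved section. *)
  rewrite -setYA (setYA O) setYK set0Y; apply: T_min; exact: hyperboloid_boost.
have := le_trans (le_trans (weight_le_mu_dS s0) H) (mu_dS_le_weight s0).
have -> : cosh s ^+ n.-1 * (cosh s ^+ 2 * tanh s) =
  tanh s * (cosh s ^+ n.-1 * cosh s ^+ 2) by rewrite mulrA mulrC.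
by rewrite (EFinM (tanh s)) -muleA lee_pmul2l// lte_fin.
Qed.

Lemma weight_agree_le_differ : (weight agree <= weight differ)%E.
Proof.
have [nu nuE] := density_measure sigma mnh (fun w => normr_ge0 (h w)).
(* The density |h| is at most 1 on the sphere, so the error sets are controlled by surface measure
   alone. *)
have nuS B : measurable B -> B `<=` S -> (nu B <= sigma B)%E.
  move=> mB BS; rewrite nuE -[leRHS]mul1e -integral_cst//.
  apply: ge0_le_integral => //.
  - by apply/measurable_EFinP; exact: measurable_funTS.
  - by move=> w Bw; rewrite lee_fin h_le1//; exact: BS.
have nufin B : measurable B -> B `<=` S -> nu B \is a fin_num.
  move=> mB BS; rewrite ge0_fin_numE// (le_lt_trans (nuS _ mB BS))//.
  by rewrite -ge0_fin_numE// fin_num_measure.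
have mA := measurable_agree; have mF := measurable_differ.
have fF : nu differ \is a fin_num by apply: nufin => // w [].
have fA : nu agree \is a fin_num by apply: nufin => // w [].
pose sk (k : nat) : R := k.+1%:R^-1.
have sk0 k : 0 < sk k by rewrite invr_gt0.
pose eps k := fine (sigma (small (sk k))).
have epsE k : sigma (small (sk k)) = (eps k)%:E.
  by rewrite fineK// fin_num_measure.
pose C (k : nat) := cosh (sk k) ^+ n.-1 * cosh (sk k) ^+ 2.
(* The exceptional set costs at most [eps k] twice: once when restored to [agree], once when added
   to [differ]. *)
have bound k : fine (nu agree) <= C k * (fine (nu differ) + eps k) + eps k.
  rewrite -lee_fin EFinD EFinM EFinD (fineK fA) (fineK fF) -epsE.
  have ms := msmall (sk k).
  have sS : small (sk k) `<=` S by move=> w [].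
  have mG : measurable (agree `\` small (sk k)) by exact: measurableD.
  apply: (@le_trans _ _ (nu (agree `\` small (sk k)) + nu (small (sk k)))%E).
    apply: (@le_trans _ _ (nu ((agree `\` small (sk k)) `|` small (sk k))));
      last exact: measureU2.
    apply: le_measure; rewrite ?inE//; first exact: measurableU.
    by move=> w Aw; have [?|?] := pselect (small (sk k) w); [right|left].
  apply: leeD; last exact: nuS.
  rewrite nuE; apply: (le_trans (weight_agree_le_small (sk0 k))).
  apply: lee_wpmul2l.
    by rewrite lee_fin mulr_ge0// exprn_ge0// ltW// cosh_gt0.
  rewrite /weight -nuE; apply: (@le_trans _ _ (nu differ + nu (small (sk k)))%E).
    exact: measureU2.
  by apply: leeD => //; exact: nuS.
rewrite /weight -!nuE -[X in (X <= _)%E]fineK// -[X in (_ <= X)%E]fineK// lee_fin.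
have eps0 : eps k @[k --> \oo] --> (0 : R).
  exact: fine_cvg (border_small_cvg0 mT Tlt Tgt b0_null).
have c1 : cosh (sk k) @[k --> \oo] --> (1 : R).
  have -> : 1 = cosh 0 :> R by rewrite /cosh oppr0 expR0 divff.
  apply: (@cvg_comp _ _ _ sk (@cosh R) _ (nbhs (0 : R))); last exact: continuous_cosh.
  exact: cvg_harmonic.
have cX m : cosh (sk k) ^+ m @[k --> \oo] --> (1 : R).
  elim: m => [|m IH]; first by under eq_fun do rewrite expr0; exact: cvg_cst.
  have cS := cvgM c1 IH; rewrite mulr1 in cS.
  under eq_fun do rewrite exprS.
  exact: cS.
have cb : C k * (fine (nu differ) + eps k) + eps k @[k --> \oo] --> fine (nu differ).
  have := cvgD (cvgM (cvgM (cX n.-1) (cX 2))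
    (cvgD (cvg_cst (fine (nu differ))) eps0)) eps0.
  by rewrite mulr1 mul1r !addr0; exact.
by apply: (ler_cvg_to (cvg_cst (fine (nu agree))) cb); exact: nearW.
Qed.

End balance.

(** * Passage to coordinates centred at [x], and recombination of the signs *)

Theorem lemma1p3 (R : realType) (n : nat) (n_ge2 : (2 <= n)%N)
    (tau : set 'cV[R]_n.+1) (tauM : sections tau)
    (x : 'cV[R]_n.+1) (xI : hyperboloid x)
    (x_min : forall p : 'cV[R]_n.+1, hyperboloid p ->
      (mu_dS (tau `+` point_section x) <= mu_dS (tau `+` point_section p))%E)
    (g : 'M[R]_n.+1) (xg : base_isometry x g)
    (b : 'cV[R]_n -> R) (b_border : border_function tau g b)
    (b_neq0 : {ae @sphere_measure R n, forall w, sphere w -> b w <> 0}) :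
  forall i : 'I_n,
    (\int[@sphere_measure R n]_(w in @sphere R n)
       (Num.sg (b w) * w i 0)%:E = 0)%E.
Proof.
move=> i; have [tau_dS mtau _ tau_fin] := tauM.
have [[gq gdet ghyp] gx _] := xg.
pose T := [set u | tau (g *m u)].
have mT : measurable T by exact: measurable_preimage (measurable_mulmx g) mtau.
have Tlt w : sphere w -> forall r, r < b w -> T (polar_dS r w).
  by move=> Sw; exact: (b_border w Sw).1.
have Tgt w : sphere w -> forall r, b w < r -> ~ T (polar_dS r w).
  by move=> Sw; exact: (b_border w Sw).2.
have transport p : mu_dS (T `+` point_section p) = mu_dS (tau `+` point_section (g *m p)).
  rewrite -(@mu_dS_isometry _ _ g (tau `+` point_section (g *m p)))//.
  - congr mu_dS; rewrite (_ : point_section p = [set u | point_section (g *m p) (g *m u)])//.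
    by apply/seteqP; split => u; rewrite /point_section /deSitter /= !gq.
  - exact: ltn_trans n_ge2.
  - by apply: measurableU; apply: measurableD => //; exact: measurable_point_section.
have hypO : hyperboloid (origin R n).
  split; last by rewrite cons_cV0.
  rewrite minkowski_cons_sqr sqr_enorm big1; first by rewrite expr1n sub0r.
  by move=> j _; rewrite mxE expr0n.
(* Finiteness is known at the origin; comparing [x] with the origin in the minimality carries it
   over to [x]. *)
have T_fin : (mu_dS (T `+` point_section (origin R n)) < +oo)%E.
  by rewrite transport gx; exact: le_lt_trans (x_min _ hypO) tau_fin.
have T_min p : hyperboloid p -> (mu_dS (T `+` point_section (origin R n)) <=
    mu_dS (T `+` point_section p))%E.
  by move=> /ghyp hp; rewrite !transport gx; exact: x_min.
have b0_null : @sphere_measure R n [set w | sphere w /\ b w = 0] = 0%E.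
  (* The hypothesis yields a measurable null superset; to bound the measure of the zero set itself,
     its measurability is also required, and it comes from the sets b > 0 and b < 0. *)
  have [N [mN N0 bN]] := b_neq0.
  apply/eqP; rewrite eq_le measure_ge0 andbT -N0; apply: le_measure; rewrite ?inE//.
    rewrite [X in measurable X](_ : _ = @sphere R n `\`
        ([set w | sphere w /\ 0 < b w] `|` [set w | sphere w /\ b w < 0])).
      apply: measurableD; first exact: measurable_sphere.
      by apply: measurableU; [exact: measurable_border_gt mT Tlt Tgt 0|
        exact: measurable_border_lt mT Tlt Tgt 0].
    apply/seteqP; split => w /=.
      by move=> [Sw ->]; split => // -[] []; rewrite ltxx.
    move=> [Sw nb]; split => //; apply/eqP; rewrite eq_le !leNgt.
    by apply/andP; split; apply/negP => ?; apply: nb; [left|right].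
  by move=> w [Sw bw0]; apply: bN => /(_ Sw).
have coord_le1 (w : 'cV[R]_n) : sphere w -> `|w i 0| <= 1.
  move=> w1; rewrite -[leRHS]w1 -sqrtr_sqr ler_sqrt; last first.
    by rewrite sumr_ge0// => j _; exact: sqr_ge0.
  rewrite (bigD1 i)//= lerDl.
  by rewrite sumr_ge0// => j _; exact: sqr_ge0.
pose e : 'cV[R]_n := delta_mx i 0.
have eE (w : 'cV[R]_n) : w i 0 = \sum_(j < n) e j 0 * w j 0.
  rewrite (bigD1 i)//= big1 ?addr0 => [|j ji].
    by rewrite mxE !eqxx mul1r.
  by rewrite mxE (negbTE ji) mul0r.
have eNE (w : 'cV[R]_n) : - w i 0 = \sum_(j < n) (- e) j 0 * w j 0.
  by rewrite eE -sumrN; apply: eq_bigr => j _; rewrite [(- e) j 0]mxE mulNr.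
have e1 : enorm e = 1.
  (* The sum of the squares of [e] is [eE] read at w = e. *)
  rewrite /enorm; under eq_bigr do rewrite expr2.
  by rewrite -eE mxE !eqxx sqrtr1.
have eN1 : enorm (- e) = 1.
  rewrite -[RHS]e1 /enorm; congr Num.sqrt; apply: eq_bigr => j _.
  by rewrite [(- e) j 0]mxE sqrrN.
pose agree := [set w : 'cV[R]_n | sphere w /\ 0 < b w * w i 0].
pose differ := [set w : 'cV[R]_n | sphere w /\ b w * w i 0 < 0].
have mA : measurable agree := measurable_agree (h := fun w => w i 0) mT Tlt Tgt eE.
have mF : measurable differ := measurable_differ (h := fun w => w i 0) mT Tlt Tgt eE.
pose W (B : set 'cV[R]_n) := (\int[@sphere_measure R n]_(w in B) `|w i 0|%:E)%E.
have coordN_le1 (w : 'cV[R]_n) : sphere w -> `|- w i 0| <= 1 by rewrite normrN; exact: coord_le1.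
(* Replacing [e] by [- e] exchanges [agree] and [differ], so the two inequalities are opposite. *)
have WE : W agree = W differ.
  apply/eqP; rewrite eq_le (weight_agree_le_differ (h := fun w => w i 0) mT Tlt Tgt e1 eE)//=.
  have := weight_agree_le_differ (h := fun w => - w i 0) mT Tlt Tgt eN1 eNE
    coordN_le1 T_fin T_min b0_null.
  rewrite (_ : [set w | _ /\ 0 < _] = differ); last first.
    by apply/seteqP; split => w /=; rewrite mulrN oppr_gt0.
  rewrite (_ : [set w | _ /\ _ < 0] = agree); last first.
    by apply/seteqP; split => w /=; rewrite mulrN oppr_lt0.
  under eq_integral do rewrite normrN.
  by under [X in (_ <= X)%E]eq_integral do rewrite normrN.
have mS := @measurable_sphere R n.
have W_fin : W agree \is a fin_num.
  rewrite ge0_fin_numE; last by apply: integral_ge0 => w _; rewrite lee_fin.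
  apply: (@le_lt_trans _ _ (@sphere_measure R n agree)).
    rewrite -[leRHS]mul1e -integral_cst//; apply: ge0_le_integral => //.
    - apply/measurable_EFinP/measurable_funTS/measurableT_comp => //.
      exact: measurable_coord.
    - by move=> w [Sw _]; rewrite lee_fin coord_le1.
  by rewrite -ge0_fin_numE// fin_num_measure.
(* Applied to the positive part of sgn(b) w_i with [agree], and to the negative part with [differ].
   The integral is the difference of these two, and [W_fin] makes that difference of equal terms
   vanish. *)
have part (f : 'cV[R]_n -> \bar R) (B : set 'cV[R]_n) : B `<=` @sphere R n ->
    (forall w, sphere w -> B w -> f w = `|w i 0|%:E) ->
    (forall w, sphere w -> ~ B w -> f w = 0%E) ->
    (\int[@sphere_measure R n]_(w in @sphere R n) f w = W B)%E.
  move=> BS fB fNB; rewrite /W -(setIidr BS) integral_mkcondr.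
  apply: eq_integral => w; rewrite inE patchE => Sw.
  by have [Bw|Bw] := boolP (w \in B); [apply: fB; rewrite ?inE in Bw *|
    apply: fNB; rewrite ?notin_setE in Bw *].
have sgE (w : 'cV[R]_n) : Num.sg (b w) * w i 0 = Num.sg (b w * w i 0) * `|w i 0|.
  by rewrite sgrM -mulrA -numEsg.
rewrite integralE (part _ agree) ?(part _ differ).
- by rewrite WE subee// -WE.
- by move=> w [].
- move=> w Sw [_ bw]; rewrite funenegE sgE (ltr0_sg bw) mulN1r EFinN oppeK.
  by apply/max_idPl; rewrite lee_fin.
- move=> w Sw nbw; rewrite funenegE sgE; apply/max_idPr.
  rewrite -EFinN lee_fin oppr_le0 mulr_ge0// sgr_ge0 leNgt.
  by apply/negP => bw; apply: nbw.
- by move=> w [].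
- move=> w Sw [_ bw]; rewrite funeposE sgE (gtr0_sg bw) mul1r.
  by apply/max_idPl; rewrite lee_fin.
- move=> w Sw nbw; rewrite funeposE sgE; apply/max_idPr.
  rewrite lee_fin mulr_le0_ge0// sgr_le0 leNgt.
  by apply/negP => bw; apply: nbw.
Qed.
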